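(* Fix $\vartheta>0$. Then there is an open set $\mathcal{D}_2\subset\mathbb{C}$ with $\mathbb{R}\subset\mathcal{D}_2$ such that $$ \lim_{n\to\infty}\frac{\mathbb{E}\, e^{zX^{(2)}_{n,\vartheta n}}}{e^{n\varphi_2(z;\vartheta)}}=\sqrt{\frac{W_0(\vartheta^{-1})+1}{W_0(\vartheta^{-1}e^{-z})+1}},\qquad z\in\mathcal{D}_2, $$ where $\varphi_2(z;\vartheta):=L_2(\vartheta e^z)-L_2(\vartheta)$. Moreover, the convergence is locally uniform on $\mathcal{D}_2$ with speed $O(1/n)$, i.e. for every compact $K\subset\mathcal{D}_2$ the supremum over $z\in K$ of the absolute difference of the two sides is $O(1/n)$ as $n\to\infty$.
   Context: Let $\genfrac{\{}{\}}{0pt}{}{n}{k}$ be the Stirling numbers of the second kind (number of partitions of an $n$-element set into $k$ non-empty blocks) and $T_n(x)=\sum_{k=1}^n\genfrac{\{}{\}}{0pt}{}{n}{k}x^k$ the Touchard polynomials. For $n\in\mathbb{N}$, $\theta>0$, the random variable $X^{(2)}_{n,\theta}$ has distribution $\mathbb{P}[X^{(2)}_{n,\theta}=k]=\genfrac{\{}{\}}{0pt}{}{n}{k}\theta^k/T_n(\theta)$, $k\in\{1,\dots,n\}$; thus $\mathbb{E}e^{zX^{(2)}_{n,\theta}}=T_n(\theta e^z)/T_n(\theta)$ for $z\in\mathbb{C}$. $W_0$ is the principal branch of the Lambert $W$-function: the analytic function on $\mathbb{C}\setminus(-\infty,-1/e]$ with $W_0(z)e^{W_0(z)}=z$ whose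 restriction to $(-1/e,\infty)$ is the inverse of $w\mapsto we^w$, $w\in(-1,\infty)$. Define $L_2(z):=W_0(1/z)+\frac{1}{W_0(1/z)}-z+\log z$ for $z\in\mathbb{C}\setminus(-\infty,0]$. Logarithms and square roots are principal branches (the set $\mathcal{D}_2$ being such that all expressions are defined on it). *)

(* Defs.v *)
From mathcomp Require Import all_boot.
From Stdlib Require Import Reals.
From Coquelicot Require Import Coquelicot.

(** Number of partitions of an [n]-element set into [k] non-empty blocks
    ([partition] requires the blocks to be non-empty). *)
Definition stirling2 (n k : nat) : nat :=
  #|[set P : {set {set 'I_n}} | partition P [set: 'I_n] & #|P| == k]|.

Local Open Scope R_scope.
Local Open Scope C_scope.

Definition touchard (n : nat) (x : R) : R :=
  sum_n_m (fun k : nat => (INR (stirling2 n k) * x ^ k)%R) 1 n.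

(** Probability mass function of $X^{(2)}_{n,\theta}$, on [{1, ..., n}]. *)
Definition X2_pmf (n : nat) (theta : R) (k : nat) : R :=
  (INR (stirling2 n k) * theta ^ k / touchard n theta)%R.

(** Expectation of [f X] when [X] has mass function [p] on [{1, ..., n}]. *)
Definition expectation (n : nat) (p : nat -> R) (f : nat -> C) : C :=
  sum_n_m (fun k : nat => RtoC (p k) * f k) 1 n.

Definition Cexp (z : C) : C :=
  ((exp (Re z) * cos (Im z))%R, (exp (Re z) * sin (Im z))%R).

(** Principal argument, with values in (-PI, PI]; junk value at 0. *)
Definition Carg (z : C) : R :=
  if Rle_dec 0 (Im z) then acos (Re z / Cmod z) else (- acos (Re z / Cmod z))%R.

Definition Clog (z : C) : C := (ln (Cmod z), Carg z).

Definition Csqrt (z : C) : C :=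
  if Ceq_dec z 0 then RtoC 0 else Cexp (Clog z / 2).

(** The complement in the complex plane of the real half-line (-oo, a]. *)
Definition slit_plane (a : R) (z : C) : Prop :=
  ~ (Im z = 0%R /\ (Re z <= a)%R).

(** These conditions determine [W] on the slit plane, by the identity theorem;
    the values of [W] on the cut are arbitrary. The last two clauses say that
    the restriction of [W] to (-1/e, +oo) is the inverse of [w |-> w e^w],
    [w] in (-1, +oo). *)
Record is_LambertW0 (W : C -> C) : Prop := {
  LambertW0_holomorphic : forall z : C, slit_plane (- exp (-1)) z ->
    ex_derive (K := C_AbsRing) (V := C_NormedModule) W z;
  LambertW0_eq : forall z : C, slit_plane (- exp (-1)) z ->
    W z * Cexp (W z) = z;
  LambertW0_real : forall x : R, (- exp (-1) < x)%R ->
    exists w : R, (-1 < w)%R /\ W (RtoC x) = RtoC w;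
  LambertW0_inverse : forall w : R, (-1 < w)%R ->
    W (RtoC (w * exp w)) = RtoC w
}.

Definition L2 (W0 : C -> C) (z : C) : C :=
  W0 (/ z) + / W0 (/ z) - z + Clog z.

Definition phi2 (W0 : C -> C) (z : C) (vartheta : R) : C :=
  L2 W0 (RtoC vartheta * Cexp z) - L2 W0 (RtoC vartheta).

Definition mgf_ratio (W0 : C -> C) (vartheta : R) (n : nat) (z : C) : C :=
  expectation n (X2_pmf n (vartheta * INR n)) (fun k => Cexp (z * INR k))
  / Cexp (INR n * phi2 W0 z vartheta).

Definition limit_quotient (W0 : C -> C) (vartheta : R) (z : C) : C :=
  (W0 (/ RtoC vartheta) + 1) / (W0 (/ RtoC vartheta * Cexp (- z)) + 1).

(** The arguments of [L2], [W0] and [Csqrt] lie in the domains on which these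
    principal branches are defined, and the denominator does not vanish. *)
Definition well_defined_at (W0 : C -> C) (vartheta : R) (z : C) : Prop :=
  slit_plane 0 (RtoC vartheta * Cexp z) /\
  slit_plane (- exp (-1)) (/ RtoC vartheta * Cexp (- z)) /\
  W0 (/ RtoC vartheta * Cexp (- z)) + 1 <> 0 /\
  slit_plane 0 (limit_quotient W0 vartheta z).

Definition compact_C (K : C -> Prop) : Prop :=
  forall (I : Type) (U : I -> C -> Prop),
    (forall i : I, open (U i)) ->
    (forall z : C, K z -> exists i : I, U i z) ->
    exists l : list I, forall z : C, K z -> exists i : I, List.In i l /\ U i z.

(* Main.v *)
(** Let [w = W0 (exp (-z) / vartheta)] and let [w1] be its value at [z = 0].
    The exponential generating function of the Touchard polynomials is
    [exp (x (exp t - 1))], so [T_n (n u) / n!] is a Fourier coefficient on any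
    circle around [0].  For [u = vartheta exp z] the circle [t = w exp (i s)]
    runs through the saddle point [w] of [u (exp t - 1) - log t], and the
    factor taken out at the saddle is exactly [exp (n L2 u)].  Hence the
    quotient in the theorem equals [J_n w / J_n w1], where [J_n w] is the integral
    over [-PI <= s <= PI] of [exp (n h)], with
    [h = (exp (w (exp (i s) - 1)) - 1) / w - i s = - (1 + w) s^2 / 2 + c s^3 + O(s^4)].
    The cubic term is odd, so [J_n w] is the Gaussian integral [G (n (1 + w))] up
    to [O(n^(-3/2))].  Finally [b G(b)^2] is constant up to an exponentially
    small error, which gives the square of the limit; the sign is fixed by
    [Re G > 0]. *)

Require Import Defs.
From mathcomp Require all_boot.
From Stdlib Require Import Reals Factorial Lra Lia.
From Coquelicot Require Import Coquelicot.

(** * Set partitions and falling factorials *)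

(** Set partitions reach the circle integral without power series: counting functions by their
    kernel expands [m^n] in falling factorials, and inserting a shift [m] gives coefficients with
    the same recurrence as the Fourier coefficients.

    The circle has a complex radius [w], so no contour is deformed: the coefficient formula holds
    for every [w], by integration by parts in the angle and by shrinking the circle to its centre.

    Uniformity shapes the estimates. They hold for complex [w] in a disc about a real [w0 > 0], with
    constants independent of [n] and [w]. At [w0] itself [Re h <= - 2 c s^2] on all of [[-PI, PI]],
    and moving to [w] changes [h] by at most [K |w - w0| s^2]; thanks to the factor [s^2], half of
    the decay survives. One Gaussian majorant then covers the whole interval and no tail is cut off.

    [D2] is the union of all discs on which the estimate holds with some constants. Discs about the
    real points exist by the above, and on a compact set finitely many constants have a maximum. *)

Module Combinatorics.
Import all_boot.
Local Open Scope nat_scope.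

(** A function with kernel [P] factors uniquely through the map sending a point to its block, and
    the factor is injective on blocks. Injections from [#|P|] blocks into [m] values are counted by
    the falling factorial. *)
Lemma card_kernel_ffun (T : finType) (m : nat) (P : {set {set T}}) :
  partition P [set: T] ->
  #|[set f : {ffun T -> 'I_m} | preim_partition f [set: T] == P]| = m ^_ #|P|.
Proof.
move=> pP; have [/eqP cP tP nP] := and3P pP.
have inP x : pblock P x \in P by rewrite pblock_mem // cP inE.
pose D := {B : {set T} | B \in P}.
pose blk x : D := Sub (pblock P x) (inP x).
pose lift (g : {ffun D -> 'I_m}) := [ffun x => g (blk x)].
have blkE x y : (blk x == blk y) = (pblock P x == pblock P y) by [].
have surj (B : D) : exists x, blk x = B.
  have [x xB] : exists x, x \in val B.
    by apply/set0Pn; apply: contraNneq nP => <-; exact: valP B.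
  by exists x; apply: val_inj; rewrite /= (def_pblock tP (valP B) xB).
have lift_inj : injective lift.
  move=> g g' /ffunP eg; apply/ffunP => B; have [x <-] := surj B.
  by have := eg x; rewrite !ffunE.
have -> : m ^_ #|P| = #|[set g : {ffun D -> 'I_m} | injectiveb g]|.
  by rewrite card_inj_ffuns card_ord card_sig; congr (_ ^_ _); apply: eq_card.
rewrite -(card_imset _ lift_inj); apply: eq_card => f; rewrite !inE.
apply/eqP/imsetP => [Pf | [g]]; last first.
  rewrite inE => /injectiveP g_inj ->.
  rewrite -[RHS](preim_partition_pblock pP).
  rewrite /preim_partition /equivalence_partition; apply: eq_imset => x.
  apply/setP => y; rewrite !inE !ffunE -blkE.
  by rewrite (inj_eq g_inj).
have fE x y : (f x == f y) = (blk x == blk y).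
  rewrite blkE eq_pblock ?cP ?inE // -Pf pblock_equivalence_partition ?inE //.
  by split=> // /eqP ->.
have [g gP] : exists g : D -> 'I_m, forall x, g (blk x) = f x.
  have ex (B : D) : exists x, blk x == B by have [x <-] := surj B; exists x.
  by exists (fun B => f (xchoose (ex B))) => x; apply/eqP; rewrite fE (xchooseP (ex _)).
exists [ffun B => g B]; last by apply/ffunP => x; rewrite !ffunE gP.
rewrite inE; apply/injectiveP => B B'; rewrite !ffunE.
have [x <-] := surj B; have [y <-] := surj B'; rewrite !gP => /eqP.
by rewrite fE => /eqP.
Qed.

(** All functions from [n] to [m] points are sorted by their kernel, and the kernels by their number
    of blocks. *)
Lemma expn_stirling2 (n m : nat) :
  m ^ n = \sum_(k < n.+1) stirling2 n k * m ^_ k.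
Proof.
transitivity #|[set: {ffun 'I_n -> 'I_m}]|.
  by rewrite cardsT card_ffun !card_ord.
have le_n (P : {set {set 'I_n}}) : partition P [set: 'I_n] -> #|P| < n.+1.
  move=> pP; rewrite ltnS -[X in _ <= X]card_ord -cardsT.
  rewrite (card_partition pP) -sum1_card; apply: leq_sum => B BP.
  by rewrite card_gt0; have [_ _] := and3P pP; apply: contraNneq => <-.
(* [inord] takes a default value out of range; [le_n] excludes this for partitions. *)
pose K (P : {set {set 'I_n}}) : 'I_n.+1 := inord #|P|.
rewrite -sum1_card.
rewrite (partition_big (fun f : {ffun 'I_n -> 'I_m} => preim_partition f [set: 'I_n])
          (fun P => partition P [set: 'I_n])) /=; last first.
  by move=> f _; exact: preim_partitionP.
rewrite (partition_big K predT) //=; apply: eq_bigr => k _.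
rewrite /stirling2 -sum_nat_const.
apply: eq_big => [P|P /andP[pP /eqP <-]].
  rewrite inE; case pP: (partition P _) => //=.
  by rewrite /K -val_eqE /= inordK ?le_n.
rewrite /K inordK ?le_n // -(card_kernel_ffun _ m _ pP) -sum1_card.
by apply: eq_bigl => f; rewrite !inE.
Qed.

(* The coefficients of [(j + m)^n] in the basis of falling factorials of [j];
   shifting [m] makes them satisfy the recurrence of the Fourier coefficients
   of [exp (m t) exp (x (exp t - 1))]. *)
Fixpoint shifted_stirling (n m k : nat) : nat :=
  if n is n'.+1 then
    m * shifted_stirling n' m k
      + (if k is k'.+1 then shifted_stirling n' m.+1 k' else 0)
  else (k == 0).

Lemma shifted_stirling_small n m k : Peano.lt n k -> shifted_stirling n m k = 0.
Proof.
move/ltP; elim: n m k => [|n IHn] m [|k] //= nk.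
by rewrite !IHn ?muln0 // ltnW.
Qed.

(** Splitting off one factor gives [(j + m)^(n+1) = m (j + m)^n + j ((j - 1) + (m + 1))^n]. The
    second term passes from shift [m] to [m + 1], and [j (j - 1)^_k = j^_(k + 1)] raises the
    index. *)
Lemma expn_shifted_stirling (n m j : nat) :
  (j + m) ^ n = \sum_(k < n.+1) shifted_stirling n m k * j ^_ k.
Proof.
elim: n m j => [|n IHn] m j; first by rewrite big_ord_recl big_ord0.
rewrite expnS mulnDl addnC [m * _](_ : _ = m * (\sum_(k < n.+2) shifted_stirling n m k * j ^_ k)); last first.
  by rewrite IHn [in RHS]big_ord_recr /= shifted_stirling_small ?mul0n ?addn0 //; apply/ltP.
have -> : j * (j + m) ^ n = \sum_(k < n.+2)
    (if nat_of_ord k is k'.+1 then shifted_stirling n m.+1 k' else 0) * j ^_ k.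
  rewrite big_ord_recl mul0n add0n.
  case: j => [|j]; first by rewrite mul0n big1 // => k _; rewrite /= ffact0n muln0.
  rewrite addSnnS IHn big_distrr /=; apply: eq_bigr => k _.
  by rewrite ffactSS mulnCA.
rewrite big_distrr -big_split /=; apply: eq_bigr => k _.
by rewrite mulnDl mulnA.
Qed.

(** The system is triangular: at [j = k] the terms of index above [k] vanish, the one of index [k]
    has the positive factor [k!], and those below agree by strong induction. *)
Lemma ffact_basis_uniq (n : nat) (a b : nat -> nat) :
  (forall j, \sum_(k < n) a k * j ^_ k = \sum_(k < n) b k * j ^_ k) ->
  forall k, k < n -> a k = b k.
Proof.
move=> eq_ab; elim/ltn_ind => k IHk ltkn.
have := eq_ab k.
rewrite -!(big_mkord predT (fun i => _ i * k ^_ i)) !(@big_cat_nat _ _ _ k.+1 0 n) //=.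
rewrite ![in X in X + _ = _]big_nat_recr //= ![in X in _ = X + _]big_nat_recr //=.
have tail (c : nat -> nat) : \sum_(k.+1 <= i < n) c i * k ^_ i = 0.
  by rewrite big_nat big1 // => i /andP[ki _]; rewrite ffact_small ?muln0.
rewrite !tail !addn0 (_ : \sum_(0 <= i < k) a i * _ = \sum_(0 <= i < k) b i * k ^_ i).
  by move/addnI/eqP; rewrite ffactnn eqn_pmul2r ?fact_gt0 // => /eqP.
rewrite !big_nat; apply: eq_bigr => i /andP[_ ik].
by rewrite IHk // (ltn_trans ik).
Qed.

Lemma stirling2_shifted (n k : nat) : Peano.le k n -> stirling2 n k = shifted_stirling n 0 k.
Proof.
move/leP=> le_kn; apply: (ffact_basis_uniq n.+1) => // j.
by rewrite -expn_stirling2 -expn_shifted_stirling addn0.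
Qed.

(** Phrased with [Nat.add] and [Nat.mul] for rewriting outside this module, where sums and products
    are mapped to the reals by [plus_INR] and [mult_INR]. *)
Lemma shifted_stirlingS n m k :
  shifted_stirling n.+1 m k.+1 = Nat.add (Nat.mul m (shifted_stirling n m k.+1)) (shifted_stirling n m.+1 k).
Proof. by []. Qed.

Lemma shifted_stirlingS0 n m :
  shifted_stirling n.+1 m 0 = Nat.mul m (shifted_stirling n m 0).
Proof. by rewrite /= addn0. Qed.

End Combinatorics.

Local Open Scope R_scope.

(** * Complex-valued functions of a real variable *)

Lemma C_ext (z z' : C) : Re z = Re z' -> Im z = Im z' -> z = z'.
Proof. destruct z, z'; simpl; congruence. Qed.

Lemma Cmod_le_Re_Im (z : C) : Cmod z <= Rabs (Re z) + Rabs (Im z).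
Proof.
  unfold Cmod. apply Rsqr_incr_0_var.
  - rewrite Rsqr_sqrt by nra. unfold Rsqr, Re, Im.
    rewrite <- (pow2_abs (fst z)), <- (pow2_abs (snd z)).
    pose proof (Rabs_pos (fst z)); pose proof (Rabs_pos (snd z)); nra.
  - pose proof (Rabs_pos (Re z)); pose proof (Rabs_pos (Im z)); lra.
Qed.

Lemma Im_le_Cmod (z : C) : Rabs (Im z) <= Cmod z.
Proof. eapply Rle_trans; [apply Rmax_r | apply Rmax_Cmod]. Qed.

Lemma Re_ge_opp_Cmod (z : C) : - Cmod z <= Re z.
Proof. pose proof (re_le_Cmod z); unfold Rabs in *; destruct Rcase_abs; lra. Qed.

Lemma Re_le_Cmod (z : C) : Re z <= Cmod z.
Proof. pose proof (re_le_Cmod z); unfold Rabs in *; destruct Rcase_abs; lra. Qed.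

Lemma Cmod_triangle_minus (z z' : C) : Cmod (z - z') <= Cmod z + Cmod z'.
Proof. unfold Cminus. rewrite <- (Cmod_opp z'). apply Cmod_triangle. Qed.

Lemma exp_monotone (x y : R) : x <= y -> exp x <= exp y.
Proof. intros [H | ->]; [left; apply exp_increasing, H | right; reflexivity]. Qed.

Lemma Cexp_plus (z z' : C) : Cexp (z + z') = (Cexp z * Cexp z')%C.
Proof.
  apply C_ext; unfold Cexp, Cplus, Cmult, Re, Im; simpl; rewrite exp_plus.
  - rewrite cos_plus; ring.
  - rewrite sin_plus; ring.
Qed.

Lemma Cexp_RtoC (x : R) : Cexp (RtoC x) = RtoC (exp x).
Proof. apply C_ext; unfold Cexp; simpl; rewrite ?cos_0, ?sin_0; ring. Qed.

Lemma Cexp_0 : Cexp 0 = 1%C.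
Proof. rewrite Cexp_RtoC, exp_0; reflexivity. Qed.

Lemma Cmod_Cexp (z : C) : Cmod (Cexp z) = exp (Re z).
Proof.
  unfold Cmod, Cexp; simpl fst; simpl snd.
  replace (_ + _) with (exp (Re z) ^ 2).
  - apply sqrt_pow2. left; apply exp_pos.
  - pose proof (sin2_cos2 (Im z)) as H; unfold Rsqr in H.
    transitivity (exp (Re z) ^ 2 * (sin (Im z) * sin (Im z) + cos (Im z) * cos (Im z)));
      [rewrite H|]; ring.
Qed.

Lemma Cexp_neq_0 (z : C) : Cexp z <> 0%C.
Proof. apply Cmod_gt_0. rewrite Cmod_Cexp. apply exp_pos. Qed.

Lemma Cexp_opp (z : C) : Cexp (- z) = (/ Cexp z)%C.
Proof.
  assert (H : (Cexp z * Cexp (- z))%C = 1%C)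
    by (rewrite <- Cexp_plus, <- Cexp_0; f_equal; ring).
  rewrite <- (Cmult_1_l (/ Cexp z)), <- H. field. apply Cexp_neq_0.
Qed.

Lemma Cexp_INR (n : nat) (z : C) : Cexp (INR n * z) = (Cexp z ^ n)%C.
Proof.
  induction n as [|n IH].
  - simpl INR. rewrite Cmult_0_l. apply Cexp_0.
  - rewrite S_INR, RtoC_plus. simpl Cpow. rewrite <- IH, <- Cexp_plus. f_equal; ring.
Qed.

(** * Componentwise differentiation *)

Definition cderiv (f : R -> C) (t : R) (d : C) : Prop :=
  is_derive (fun t => Re (f t)) t (Re d) /\ is_derive (fun t => Im (f t)) t (Im d).

(** The working rule for derivatives below: a value is computed structurally, then function and
    value are brought to the wanted form by algebra. *)
Lemma cderiv_eq (f g : R -> C) (t : R) (d e : C) :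
  cderiv f t d -> (forall s, f s = g s) -> d = e -> cderiv g t e.
Proof.
  intros [H1 H2] E <-; split; [eapply is_derive_ext; [|exact H1] | eapply is_derive_ext; [|exact H2]];
  intros s; simpl; rewrite E; reflexivity.
Qed.

Lemma cderiv_const (c : C) (t : R) : cderiv (fun _ => c) t 0.
Proof. split; apply (is_derive_const (V := R_NormedModule)). Qed.

Lemma cderiv_RtoC (f : R -> R) (t d : R) :
  is_derive f t d -> cderiv (fun s => RtoC (f s)) t (RtoC d).
Proof. intros H; split; [exact H | exact (is_derive_const (K := R_AbsRing) (V := R_NormedModule) 0 t)]. Qed.

Lemma cderiv_id (t : R) : cderiv RtoC t 1.
Proof. apply (cderiv_RtoC (fun s => s)), (is_derive_id (K := R_AbsRing)). Qed.

Lemma cderiv_plus (f g : R -> C) (t : R) (d e : C) :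
  cderiv f t d -> cderiv g t e -> cderiv (fun s => f s + g s)%C t (d + e)%C.
Proof.
  intros [H1 H2] [H3 H4]; split.
  - exact (is_derive_plus (V := R_NormedModule) _ _ _ _ _ H1 H3).
  - exact (is_derive_plus (V := R_NormedModule) _ _ _ _ _ H2 H4).
Qed.

Lemma cderiv_mult (f g : R -> C) (t : R) (d e : C) :
  cderiv f t d -> cderiv g t e -> cderiv (fun s => f s * g s)%C t (d * g t + f t * e)%C.
Proof.
  intros [H1 H2] [H3 H4]; split.
  - pose proof (is_derive_minus (V := R_NormedModule) _ _ _ _ _
      (is_derive_mult _ _ _ _ _ H1 H3 Rmult_comm) (is_derive_mult _ _ _ _ _ H2 H4 Rmult_comm)) as H.
    replace (Re (d * g t + f t * e)) with (minus (plus (mult (Re d) (Re (g t))) (mult (Re (f t)) (Re e)))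
      (plus (mult (Im d) (Im (g t))) (mult (Im (f t)) (Im e)))); [exact H|].
    unfold minus, plus, mult, opp, Re, Im; simpl; ring.
  - pose proof (is_derive_plus (V := R_NormedModule) _ _ _ _ _
      (is_derive_mult _ _ _ _ _ H1 H4 Rmult_comm) (is_derive_mult _ _ _ _ _ H2 H3 Rmult_comm)) as H.
    replace (Im (d * g t + f t * e)) with (plus (plus (mult (Re d) (Im (g t))) (mult (Re (f t)) (Im e)))
      (plus (mult (Im d) (Re (g t))) (mult (Im (f t)) (Re e)))); [exact H|].
    unfold plus, mult, Re, Im; simpl; ring.
Qed.

Lemma cderiv_scal (c : C) (f : R -> C) (t : R) (d : C) :
  cderiv f t d -> cderiv (fun s => c * f s)%C t (c * d)%C.
Proof.
  intros H. eapply cderiv_eq; [apply (cderiv_mult _ _ _ _ _ (cderiv_const c t) H)| reflexivity|].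
  simpl; ring.
Qed.

Lemma cderiv_minus (f g : R -> C) (t : R) (d e : C) :
  cderiv f t d -> cderiv g t e -> cderiv (fun s => f s - g s)%C t (d - e)%C.
Proof.
  intros H1 H2. eapply cderiv_eq; [apply (cderiv_plus _ _ _ _ _ H1 (cderiv_scal (-1) _ _ _ H2)) | |].
  - intros s; simpl; ring.
  - ring.
Qed.

Lemma cderiv_Cexp (f : R -> C) (t : R) (d : C) :
  cderiv f t d -> cderiv (fun s => Cexp (f s)) t (d * Cexp (f t))%C.
Proof.
  intros [H1 H2].
  pose proof (is_derive_comp exp _ _ _ _ (is_derive_exp (Re (f t))) H1) as He.
  pose proof (is_derive_comp cos _ _ _ _ (is_derive_cos (Im (f t))) H2) as Hc.
  pose proof (is_derive_comp sin _ _ _ _ (is_derive_sin (Im (f t))) H2) as Hs.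
  split.
  - pose proof (is_derive_mult _ _ _ _ _ He Hc Rmult_comm) as H.
    evar (l : R). replace (Re (d * Cexp (f t))) with l; [exact H|].
    unfold l, plus, mult, scal, Re, Im; simpl; unfold mult, Re, Im; simpl; ring.
  - pose proof (is_derive_mult _ _ _ _ _ He Hs Rmult_comm) as H.
    evar (l : R). replace (Im (d * Cexp (f t))) with l; [exact H|].
    unfold l, plus, mult, scal, Re, Im; simpl; unfold mult, Re, Im; simpl; ring.
Qed.

Definition ccont (f : R -> C) : Prop :=
  forall t, continuous (fun s => Re (f s)) t /\ continuous (fun s => Im (f s)) t.

Lemma cderiv_ccont (f : R -> C) (f' : R -> C) :
  (forall t, cderiv f t (f' t)) -> ccont f.
Proof.
  intros H t; destruct (H t) as [H1 H2]; split;
  apply (ex_derive_continuous (K := R_AbsRing) (V := R_NormedModule)); eexists; eassumption.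
Qed.

(** * Componentwise integration *)

Definition CInt (f : R -> C) (a b : R) : C :=
  (RInt (fun s => Re (f s)) a b, RInt (fun s => Im (f s)) a b).

Lemma ex_RInt_cont (f : R -> R) (a b : R) : (forall t, continuous f t) -> ex_RInt f a b.
Proof. intros H; apply (ex_RInt_continuous (V := R_CompleteNormedModule)); intros; apply H. Qed.

Lemma ccont_Re f : ccont f -> forall t, continuous (fun s => Re (f s)) t.
Proof. intros H t; apply H. Qed.

Lemma ccont_Im f : ccont f -> forall t, continuous (fun s => Im (f s)) t.
Proof. intros H t; apply H. Qed.

Lemma CInt_ext (f g : R -> C) (a b : R) : (forall s, f s = g s) -> CInt f a b = CInt g a b.
Proof.
  intros E; apply C_ext; apply (RInt_ext (V := R_CompleteNormedModule)); intros; rewrite E; reflexivity.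
Qed.

Lemma CInt_plus (f g : R -> C) (a b : R) : ccont f -> ccont g ->
  CInt (fun s => f s + g s)%C a b = (CInt f a b + CInt g a b)%C.
Proof.
  intros Hf Hg; apply C_ext.
  - apply (RInt_plus (V := R_CompleteNormedModule)); apply ex_RInt_cont; apply ccont_Re; assumption.
  - apply (RInt_plus (V := R_CompleteNormedModule)); apply ex_RInt_cont; apply ccont_Im; assumption.
Qed.

Lemma CInt_scal (c : C) (f : R -> C) (a b : R) : ccont f ->
  CInt (fun s => c * f s)%C a b = (c * CInt f a b)%C.
Proof.
  intros Hf.
  assert (E1 := ex_RInt_cont _ a b (ccont_Re _ Hf)).
  assert (E2 := ex_RInt_cont _ a b (ccont_Im _ Hf)).
  assert (S : forall k h, ex_RInt h a b -> RInt (fun s => k * h s) a b = k * RInt h a b)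
    by (intros k h; exact (RInt_scal (V := R_CompleteNormedModule) h a b k)).
  assert (X : forall k h, ex_RInt h a b -> ex_RInt (fun s => k * h s) a b)
    by (intros k h; exact (ex_RInt_scal (V := R_NormedModule) h a b k)).
  apply C_ext; simpl.
  - unfold Re, Im in *.
    rewrite (RInt_minus (V := R_CompleteNormedModule) (fun s => fst c * fst (f s)) (fun s => snd c * snd (f s)))
     by (apply X; assumption).
    rewrite !S by assumption. reflexivity.
  - unfold Re, Im in *.
    rewrite (RInt_plus (V := R_CompleteNormedModule) (fun s => fst c * snd (f s)) (fun s => snd c * fst (f s)))
     by (apply X; assumption).
    rewrite !S by assumption. reflexivity.
Qed.

Lemma ccont_plus f g : ccont f -> ccont g -> ccont (fun s => f s + g s)%C.
Proof.
  intros Hf Hg t; destruct (Hf t), (Hg t); split;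
  apply (continuous_plus (V := R_NormedModule)); assumption.
Qed.

Lemma ccont_mult f g : ccont f -> ccont g -> ccont (fun s => f s * g s)%C.
Proof.
  intros Hf Hg t; destruct (Hf t), (Hg t); split.
  - apply (continuous_minus (V := R_NormedModule)); apply (continuous_mult (K := R_AbsRing)); assumption.
  - apply (continuous_plus (V := R_NormedModule)); apply (continuous_mult (K := R_AbsRing)); assumption.
Qed.

Lemma ccont_const c : ccont (fun _ => c).
Proof. apply (cderiv_ccont _ (fun _ => 0%C)); intros; apply cderiv_const. Qed.

Lemma ccont_scal c f : ccont f -> ccont (fun s => c * f s)%C.
Proof. intros; apply ccont_mult; [apply ccont_const | assumption]. Qed.

Lemma ccont_ext f g : ccont f -> (forall s, f s = g s) -> ccont g.
Proof.
  intros H E t; destruct (H t) as [H1 H2]; split;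
    [eapply continuous_ext; [|exact H1] | eapply continuous_ext; [|exact H2]];
    intros s; simpl; rewrite E; reflexivity.
Qed.

Lemma ccont_minus f g : ccont f -> ccont g -> ccont (fun s => f s - g s)%C.
Proof.
  intros Hf Hg; eapply ccont_ext; [apply (ccont_plus _ _ Hf (ccont_scal (-1) _ Hg))|].
  intros s; simpl; ring.
Qed.

Lemma CInt_minus (f g : R -> C) (a b : R) : ccont f -> ccont g ->
  CInt (fun s => f s - g s)%C a b = (CInt f a b - CInt g a b)%C.
Proof.
  intros Hf Hg.
  rewrite (CInt_ext _ (fun s => f s + (-1) * g s)%C) by (intros; ring).
  rewrite CInt_plus, CInt_scal; [ring|..]; try assumption.
  apply ccont_scal; assumption.
Qed.

Lemma CInt_const (c : C) (a b : R) : CInt (fun _ => c) a b = (c * RtoC (b - a))%C.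
Proof. apply C_ext; simpl; rewrite RInt_const; unfold scal, Re, Im; simpl; unfold mult; simpl; ring. Qed.

Lemma CInt_derive (f f' : R -> C) (a b : R) :
  (forall t, cderiv f t (f' t)) -> ccont f' -> CInt f' a b = (f b - f a)%C.
Proof.
  intros H Hc; apply C_ext; simpl; apply is_RInt_unique.
  - apply (is_RInt_derive (V := R_CompleteNormedModule) (fun s => Re (f s))); intros; [apply H | apply Hc].
  - apply (is_RInt_derive (V := R_CompleteNormedModule) (fun s => Im (f s))); intros; [apply H | apply Hc].
Qed.

Lemma RInt_abs_le (f g : R -> R) (a b : R) : a <= b ->
  (forall t, continuous f t) -> (forall t, continuous g t) ->
  (forall s, a < s < b -> Rabs (f s) <= g s) -> Rabs (RInt f a b) <= RInt g a b.
Proof.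
  intros Hab Hf Hg H. apply Rabs_le; split.
  - rewrite <- (Ropp_involutive (RInt f a b)). apply Ropp_le_contravar.
    replace (- RInt f a b) with (RInt (fun s => - f s) a b)
      by apply (RInt_opp (V := R_CompleteNormedModule)), ex_RInt_cont, Hf.
    apply RInt_le; [assumption| | apply ex_RInt_cont, Hg |].
    + apply (ex_RInt_opp (V := R_NormedModule)), ex_RInt_cont, Hf.
    + intros s Hs; specialize (H s Hs); unfold Rabs in H; destruct Rcase_abs; lra.
  - apply RInt_le; [assumption| apply ex_RInt_cont, Hf | apply ex_RInt_cont, Hg |].
    intros s Hs; specialize (H s Hs); unfold Rabs in H; destruct Rcase_abs; lra.
Qed.

(** The factor 2 comes from bounding real and imaginary parts separately. *)
Lemma Cmod_CInt_le (f : R -> C) (g : R -> R) (a b : R) : a <= b ->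
  ccont f -> (forall t, continuous g t) ->
  (forall s, a < s < b -> Cmod (f s) <= g s) -> Cmod (CInt f a b) <= 2 * RInt g a b.
Proof.
  intros Hab Hf Hg H.
  eapply Rle_trans; [apply Cmod_le_Re_Im|]; simpl.
  assert (Rabs (RInt (fun s => Re (f s)) a b) <= RInt g a b).
  { apply RInt_abs_le; [assumption | apply ccont_Re, Hf | assumption |].
    intros s Hs; eapply Rle_trans; [apply re_le_Cmod | auto]. }
  assert (Rabs (RInt (fun s => Im (f s)) a b) <= RInt g a b).
  { apply RInt_abs_le; [assumption | apply ccont_Im, Hf | assumption |].
    intros s Hs; eapply Rle_trans; [apply Im_le_Cmod | auto]. }
  lra.
Qed.

(** * Mean value inequalities and remainders of the exponential *)

Lemma mvt_abs (f f' : R -> R) (x y D : R) :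
  (forall t, Rmin x y <= t <= Rmax x y -> is_derive f t (f' t) /\ Rabs (f' t) <= D) ->
  Rabs (f y - f x) <= D * Rabs (y - x).
Proof.
  intros H.
  destruct (MVT_gen f x y f') as [c [Hc E]].
  - intros; apply H; lra.
  - intros t Ht. apply continuity_pt_filterlim.
    apply (ex_derive_continuous (K := R_AbsRing) (V := R_NormedModule)). exists (f' t). apply H; lra.
  - rewrite E, Rabs_mult. apply Rmult_le_compat_r; [apply Rabs_pos | apply H, Hc].
Qed.

(* The factor 2 is the price of applying the real theorem to each component. *)
Lemma cmvt (f f' : R -> C) (x y D : R) :
  (forall t, Rmin x y <= t <= Rmax x y -> cderiv f t (f' t) /\ Cmod (f' t) <= D) ->
  Cmod (f y - f x) <= 2 * D * Rabs (y - x).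
Proof.
  intros H. eapply Rle_trans; [apply Cmod_le_Re_Im|].
  assert (Rabs (Re (f y) - Re (f x)) <= D * Rabs (y - x)).
  { apply (mvt_abs (fun t => Re (f t)) (fun t => Re (f' t))); intros t Ht; split; [apply H, Ht|].
    eapply Rle_trans; [apply re_le_Cmod | apply H, Ht]. }
  assert (Rabs (Im (f y) - Im (f x)) <= D * Rabs (y - x)).
  { apply (mvt_abs (fun t => Im (f t)) (fun t => Im (f' t))); intros t Ht; split; [apply H, Ht|].
    eapply Rle_trans; [apply Im_le_Cmod | apply H, Ht]. }
  unfold Cminus, Copp, Cplus, Re, Im in *; simpl in *.
  unfold Rminus in *; lra.
Qed.

Lemma Rabs_between (t s : R) : Rmin 0 s <= t <= Rmax 0 s -> Rabs t <= Rabs s.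
Proof.
  unfold Rmin, Rmax; repeat destruct Rle_dec; unfold Rabs; repeat destruct Rcase_abs; lra.
Qed.

(** Raises the order of vanishing at 0 by one at the cost of a factor 2; iterating it replaces
    Taylor's formula for complex values. *)
Lemma cmvt_pow (f f' : R -> C) (K s : R) (k : nat) : 0 <= K -> f 0 = 0%C ->
  (forall t, Rabs t <= Rabs s -> cderiv f t (f' t) /\ Cmod (f' t) <= K * Rabs t ^ k) ->
  Cmod (f s) <= 2 * K * Rabs s ^ S k.
Proof.
  intros HK H0 H.
  replace (f s) with (f s - f 0)%C by (rewrite H0; ring).
  eapply Rle_trans; [apply (cmvt f f' 0 s (K * Rabs s ^ k))|].
  - intros t Ht; apply Rabs_between in Ht; split; [apply H, Ht|].
    eapply Rle_trans; [apply H, Ht|]. apply Rmult_le_compat_l; [assumption|].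
    apply pow_incr; split; [apply Rabs_pos | assumption].
  - rewrite Rminus_0_r; simpl; right; ring.
Qed.

Section Exponential_bounds.

Variables (X Y : C) (M : R).
Hypotheses (HX : Re X <= M) (HY : Re Y <= M).

Let path (t : R) : C := (Y + t * (X - Y))%C.

Local Lemma path_Re t : Rmin 0 1 <= t <= Rmax 0 1 -> Cmod (Cexp (path t)) <= exp M.
Proof.
  rewrite Rmin_left, Rmax_right by lra; intros Ht.
  rewrite Cmod_Cexp. apply exp_monotone.
  unfold path, Cminus, Cplus, Cmult, Copp, Re in *; simpl in *; nra.
Qed.

Local Lemma path_deriv t : cderiv (fun t => Cexp (path t)) t ((X - Y) * Cexp (path t))%C.
Proof.
  apply cderiv_Cexp. eapply cderiv_eq;
  [apply (cderiv_plus _ _ _ _ _ (cderiv_const Y t) (cderiv_scal (X - Y)%C _ _ _ (cderiv_id t)))| |].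
  - intros s; unfold path; simpl; ring.
  - simpl; ring.
Qed.

(** Mean value inequality along the segment from [Y] to [X], on which the real part stays below [M].
    Keeping [exp M] explicit matters: later [M = - q s^2], so that differences retain a Gaussian
    factor. *)
Lemma Cexp_lipschitz : Cmod (Cexp X - Cexp Y) <= 2 * Cmod (X - Y) * exp M.
Proof.
  replace (Cexp X - Cexp Y)%C with (Cexp (path 1) - Cexp (path 0))%C
    by (unfold path; f_equal; [|f_equal]; f_equal; ring).
  eapply Rle_trans; [apply (cmvt (fun t => Cexp (path t)) (fun t => (X - Y) * Cexp (path t))%C 0 1 (Cmod (X - Y) * exp M))|].
  - intros t Ht; split; [apply path_deriv|]. rewrite Cmod_mult.
    apply Rmult_le_compat_l; [apply Cmod_ge_0 | apply path_Re, Ht].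
  - rewrite Rminus_0_r, Rabs_R1; lra.
Qed.

End Exponential_bounds.

(** Along the segment the remainder has derivative [(X - Y) (exp (path t) - exp Y)], to which the
    Lipschitz bound applies; the two mean value steps give the factor 4. *)
Lemma Cexp_taylor2 (X Y : C) (M : R) : Re X <= M -> Re Y <= M ->
  Cmod (Cexp X - Cexp Y * (1 + (X - Y))) <= 4 * Cmod (X - Y) ^ 2 * exp M.
Proof.
  intros HX HY.
  set (path := fun t : R => (Y + t * (X - Y))%C).
  replace (Cexp X - Cexp Y * (1 + (X - Y)))%C with
    ((fun t : R => Cexp (path t) - Cexp Y * (X - Y) * t)%C 1
     - (fun t : R => Cexp (path t) - Cexp Y * (X - Y) * t)%C 0)%C.
  2:{ unfold path. replace (Y + 1 * (X - Y))%C with X by ring.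
      replace (Y + 0 * (X - Y))%C with Y by ring. ring. }
  eapply Rle_trans; [apply (cmvt (fun t : R => Cexp (path t) - Cexp Y * (X - Y) * t)%C (fun t => (X - Y) * (Cexp (path t) - Cexp Y))%C 0 1
    (2 * Cmod (X - Y) ^ 2 * exp M))|].
  - intros t Ht; split.
    + eapply cderiv_eq; [apply (cderiv_minus _ _ _ _ _ (path_deriv X Y t) (cderiv_scal (Cexp Y * (X - Y))%C _ _ _ (cderiv_id t)))| |].
      * intros s; reflexivity.
      * unfold path; simpl; ring.
    + rewrite Rmin_left, Rmax_right in Ht by lra.
      rewrite Cmod_mult.
      assert (L : Cmod (Cexp (path t) - Cexp Y) <= 2 * Cmod (path t - Y) * exp M).
      { apply Cexp_lipschitz; [|assumption].
        unfold path, Cminus, Cplus, Cmult, Copp, Re in *; simpl in *; nra. }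
      replace (path t - Y)%C with (t * (X - Y))%C in L by (unfold path; ring).
      rewrite Cmod_mult, Cmod_R, Rabs_pos_eq in L by lra.
      pose proof (Cmod_ge_0 (X - Y)). pose proof (exp_pos M).
      replace (2 * Cmod (X - Y) ^ 2 * exp M) with (Cmod (X - Y) * (2 * Cmod (X - Y) * exp M)) by ring.
      apply Rmult_le_compat_l; [assumption|].
      eapply Rle_trans; [exact L|]. apply Rmult_le_compat_r; nra.
  - rewrite Rminus_0_r, Rabs_R1; lra.
Qed.

(** * Differentiation under the integral sign *)

Lemma cderiv_quadratic (M : R -> C) (t : R) (d : C) (K : R) :
  (forall u, Rabs (u - t) <= 1 -> Cmod (M u - M t - RtoC (u - t) * d) <= K * (u - t) ^ 2) ->
  cderiv M t d.
Proof.
  intros H.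
  assert (HK : 0 <= K).
  { specialize (H (t + 1)). replace (t + 1 - t) with 1 in H by ring.
    rewrite Rabs_R1 in H. pose proof (Cmod_ge_0 (M (t + 1) - M t - RtoC 1 * d)). specialize (H ltac:(lra)). lra. }
  assert (Q : forall (m : R -> R) (l : R),
    (forall u, Rabs (u - t) <= 1 -> Rabs (m u - m t - (u - t) * l) <= K * (u - t) ^ 2) -> is_derive m t l).
  { intros m l Hm. apply is_derive_Reals. intros eps He.
    (* [K + 1] instead of [K], since [K] may be 0. *)
    assert (Hd : 0 < Rmin 1 (eps / (K + 1))).
    { apply Rmin_pos; [lra|]. apply Rdiv_lt_0_compat; lra. }
    exists (mkposreal _ Hd). simpl. intros h Hh Hlt.
    assert (Hh1 : Rabs h < 1) by (eapply Rlt_le_trans; [exact Hlt | apply Rmin_l]).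
    assert (Hh2 : Rabs h < eps / (K + 1)) by (eapply Rlt_le_trans; [exact Hlt | apply Rmin_r]).
    specialize (Hm (t + h)). replace (t + h - t) with h in Hm by ring.
    specialize (Hm ltac:(lra)).
    replace ((m (t + h) - m t) / h - l) with ((m (t + h) - m t - h * l) / h) by (field; assumption).
    unfold Rdiv. rewrite Rabs_mult, Rabs_inv.
    assert (0 < Rabs h) by (apply Rabs_pos_lt; assumption).
    apply (Rmult_lt_reg_r (Rabs h)); [assumption|].
    rewrite Rmult_assoc, Rinv_l, Rmult_1_r by lra.
    eapply Rle_lt_trans; [exact Hm|]. rewrite <- (pow2_abs h).
    apply (Rmult_lt_compat_l (K + 1)) in Hh2; [|lra].
    replace ((K + 1) * (eps / (K + 1))) with eps in Hh2 by (field; lra). nra. }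
  split; apply Q; intros u Hu; (eapply Rle_trans; [|exact (H u Hu)]).
  - eapply Rle_trans; [|apply re_le_Cmod].
    right; f_equal; unfold Cminus, Cplus, Cmult, Copp, RtoC, Re; simpl; ring.
  - eapply Rle_trans; [|apply Im_le_Cmod].
    right; f_equal; unfold Cminus, Cplus, Cmult, Copp, RtoC, Im; simpl; ring.
Qed.

(** A uniform bound on the second parameter derivative makes the first-order remainder quadratic in
    [u - t], uniformly in [s], so it may be integrated. In [8 K (b - a)] two mean value steps
    contribute 4 and the integral 2. *)
Lemma cderiv_CInt_param (F F1 F2 : R -> R -> C) (a b K t : R) : a <= b ->
  (forall u s, cderiv (fun v => F v s) u (F1 u s)) ->
  (forall u s, cderiv (fun v => F1 v s) u (F2 u s)) ->
  (forall u, ccont (F u)) -> (forall u, ccont (F1 u)) ->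
  (forall u s, Rabs (u - t) <= 1 -> a < s < b -> Cmod (F2 u s) <= K) ->
  cderiv (fun u => CInt (F u) a b) t (CInt (F1 t) a b).
Proof.
  intros Hab H1 H2 C0 C1 HK.
  apply (cderiv_quadratic _ _ _ (8 * K * (b - a))).
  intros u Hu.
  rewrite <- CInt_minus, <- CInt_scal, <- CInt_minus by
    (try apply ccont_minus; try apply ccont_scal; auto).
  eapply Rle_trans; [apply (Cmod_CInt_le _ (fun _ => 4 * K * (u - t) ^ 2) _ _ Hab)|].
  - apply ccont_minus; [apply ccont_minus|apply ccont_scal]; auto.
  - intros; apply continuous_const.
  - intros s Hs.
    assert (B : forall v, Rmin t u <= v <= Rmax t u -> Rabs (v - t) <= Rabs (u - t)).
    { intros v Hv. unfold Rmin, Rmax in Hv; destruct Rle_dec; unfold Rabs; repeat destruct Rcase_abs; lra. }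
    replace (F u s - F t s - RtoC (u - t) * F1 t s)%C with
      ((fun v : R => F v s - F1 t s * v)%C u - (fun v : R => F v s - F1 t s * v)%C t)%C
      by (rewrite RtoC_minus; ring).
    eapply Rle_trans; [apply (cmvt (fun v : R => F v s - F1 t s * v)%C (fun v => F1 v s - F1 t s)%C t u (2 * K * Rabs (u - t)))|].
    + intros v Hv; split.
      * eapply cderiv_eq; [apply (cderiv_minus _ _ _ _ _ (H1 v s) (cderiv_scal (F1 t s) _ _ _ (cderiv_id v)))| |].
        -- reflexivity.
        -- simpl; ring.
      * assert (0 <= K).
        { eapply Rle_trans; [apply Cmod_ge_0 | apply (HK t s); [|assumption]]. rewrite Rminus_diag, Rabs_R0; lra. }
        eapply Rle_trans; [apply (cmvt (fun v => F1 v s) (fun v => F2 v s) t v K)|].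
        -- intros q Hq; split; [apply H2 | apply HK; [|assumption]].
           eapply Rle_trans; [|exact Hu]. apply B.
           revert Hv Hq; unfold Rmin, Rmax; repeat destruct Rle_dec; lra.
        -- specialize (B v Hv). nra.
    + rewrite <- (pow2_abs (u - t)). right; ring.
  - rewrite RInt_const. unfold scal; simpl; unfold mult; simpl. right; ring.
Qed.

(** * Touchard polynomials as Fourier coefficients *)

Definition cis (s : R) : C := Cexp (Ci * s).

Lemma cderiv_cis (s : R) : cderiv cis s (Ci * cis s)%C.
Proof.
  eapply cderiv_eq; [apply cderiv_Cexp, (cderiv_scal Ci _ _ _ (cderiv_id s))| reflexivity |].
  unfold cis; ring.
Qed.

Lemma Cmod_cis (s : R) : Cmod (cis s) = 1.
Proof.
  unfold cis. rewrite Cmod_Cexp. replace (Re (Ci * s)) with 0; [apply exp_0|].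
  unfold Ci, Re; simpl; ring.
Qed.

Lemma cis_add (s t : R) : cis (s + t) = (cis s * cis t)%C.
Proof. unfold cis; rewrite <- Cexp_plus, RtoC_plus; f_equal; ring. Qed.

Lemma cis_0 : cis 0 = 1%C.
Proof. unfold cis; rewrite Cmult_0_r; apply Cexp_0. Qed.

Lemma cis_pow (n : nat) (s : R) : (cis s ^ n)%C = cis (INR n * s).
Proof. unfold cis. rewrite <- Cexp_INR, RtoC_mult. f_equal; ring. Qed.

Lemma cis_eq (s : R) : cis s = (cos s, sin s).
Proof.
  apply C_ext; unfold cis, Cexp, Ci, Re, Im; simpl.
  - replace (0 * s - 1 * 0) with 0 by ring; replace (0 * 0 + 1 * s) with s by ring; rewrite exp_0; ring.
  - replace (0 * s - 1 * 0) with 0 by ring; replace (0 * 0 + 1 * s) with s by ring; rewrite exp_0; ring.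
Qed.

(** Periodicity at the endpoints, which cancels the boundary terms of the integrations by parts. *)
Lemma cis_PI (n : nat) : cis (INR n * PI) = cis (INR n * - PI).
Proof.
  rewrite <- !cis_pow, !cis_eq, cos_neg, sin_neg, sin_PI, Ropp_0. reflexivity.
Qed.

Lemma ccont_cis : ccont cis.
Proof. exact (cderiv_ccont _ _ cderiv_cis). Qed.

(* The exponential generating function of [n |-> E (m + X)^n] for the umbral
   variable [X] with factorial moments [x^k]; [m = 0] gives the Touchard polynomials. *)
Definition touchard_egf (x : C) (m : nat) (t : C) : C :=
  Cexp (INR m * t + x * (Cexp t - 1)).

(** Multiplying by [exp t] raises the index from [m] to [m + 1], so the family is closed under
    differentiation, with the recurrence of [shifted_stirling]. *)
Lemma cderiv_touchard_egf (x : C) (m : nat) (f : R -> C) (s : R) (d : C) :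
  cderiv f s d ->
  cderiv (fun s => touchard_egf x m (f s)) s
    (d * (INR m * touchard_egf x m (f s) + x * touchard_egf x (S m) (f s)))%C.
Proof.
  intros H. unfold touchard_egf.
  eapply cderiv_eq; [apply cderiv_Cexp, cderiv_plus;
    [apply cderiv_scal, H | apply cderiv_scal, cderiv_minus; [apply cderiv_Cexp, H | apply cderiv_const]] | reflexivity |].
  cbv beta.
  rewrite S_INR, RtoC_plus.
  replace ((INR m + 1) * f s + x * (Cexp (f s) - 1))%C with
    (f s + (INR m * f s + x * (Cexp (f s) - 1)))%C by ring.
  rewrite (Cexp_plus (f s)). ring.
Qed.

Lemma Cmod_touchard_egf_le (x t : C) (m : nat) (r : R) : Cmod t <= r ->
  Cmod (touchard_egf x m t) <= exp (INR m * r + Cmod x * (exp r + 1)).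
Proof.
  intros Ht. unfold touchard_egf. rewrite Cmod_Cexp. apply exp_monotone.
  eapply Rle_trans; [apply Re_le_Cmod|]. eapply Rle_trans; [apply Cmod_triangle|].
  rewrite !Cmod_mult, Cmod_R, Rabs_pos_eq by apply pos_INR.
  apply Rplus_le_compat; [apply Rmult_le_compat_l; [apply pos_INR | exact Ht]|].
  apply Rmult_le_compat_l; [apply Cmod_ge_0|].
  eapply Rle_trans; [apply Cmod_triangle_minus|]. rewrite Cmod_1, Cmod_Cexp.
  apply Rplus_le_compat_r, exp_monotone. eapply Rle_trans; [apply Re_le_Cmod | exact Ht].
Qed.

Lemma cderiv_circle (w : C) (s : R) : cderiv (fun s => w * cis s)%C s (Ci * (w * cis s))%C.
Proof.
  eapply cderiv_eq; [apply (cderiv_scal w _ _ _ (cderiv_cis s)) | reflexivity | ring].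
Qed.

Lemma ccont_touchard_egf_circle (x : C) (m : nat) (w : C) :
  ccont (fun s => touchard_egf x m (w * cis s)).
Proof. eapply cderiv_ccont; intros s; apply cderiv_touchard_egf, cderiv_circle. Qed.

(** Mean value property of an entire function with value 1 at 0. On the circle of radius [u w] the
    derivative in [u] is the derivative in the angle divided by [Ci * u]; the latter integrates to 0
    by periodicity, so the mean does not change while [u] shrinks from 1 to 0. *)
Lemma touchard_egf_mean (x : C) (m : nat) (w : C) :
  CInt (fun s => touchard_egf x m (w * cis s)) (- PI) PI = RtoC (2 * PI).
Proof.
  pose (F := fun (u s : R) => touchard_egf x m (u * w * cis s)).
  pose (D := fun k (u s : R) => (INR k * touchard_egf x k (u * w * cis s) + x * touchard_egf x (S k) (u * w * cis s))%C).
  assert (Hu : forall u s, cderiv (fun u => u * w * cis s)%C u (w * cis s)%C).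
  { intros u s. eapply cderiv_eq; [apply (cderiv_scal (w * cis s)%C _ _ _ (cderiv_id u))| |]; intros; simpl; ring. }
  assert (cD : forall k u, ccont (D k u)).
  { intros k u. apply ccont_plus; apply ccont_scal, (ccont_touchard_egf_circle x _ (u * w)). }
  assert (dF : forall u s, cderiv (F u) s (Ci * (u * w * cis s) * D m u s)%C).
  { intros u s. apply cderiv_touchard_egf, cderiv_circle. }
  assert (pc : - PI <= PI) by (pose proof PI_RGT_0; lra).
  assert (dM : forall t, 0 <= t <= 1 -> cderiv (fun u => CInt (F u) (- PI) PI) t 0).
  { intros t Ht.
    assert (Z : CInt (fun s => w * cis s * D m t s)%C (- PI) PI = 0%C).
    (* The division by [t] excludes [t = 0]; there [D m t] is constant in [s] and only the integral
       of [cis] remains. *)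
    { destruct (Req_dec t 0) as [-> | Hn].
      - rewrite (CInt_ext _ (fun s => (w * D m 0 0) * cis s)%C).
        2:{ intros s; unfold D. rewrite !Cmult_0_l. ring. }
        rewrite CInt_scal by apply ccont_cis.
        rewrite (CInt_derive (fun s => - Ci * cis s)%C); [|intros s|apply ccont_cis].
        + pose proof (cis_PI 1) as E. simpl INR in E. rewrite !Rmult_1_l in E. rewrite E. ring.
        + eapply cderiv_eq; [apply cderiv_scal, cderiv_cis| reflexivity |].
          apply C_ext; unfold Re, Im; simpl; ring.
      - rewrite (CInt_ext _ (fun s => (/ (Ci * t)) * (Ci * (t * w * cis s) * D m t s))%C).
        2:{ intros s. field. split; [intros E; apply Hn, RtoC_inj, E | apply Ci_nz]. }
        assert (cc : ccont (fun s : R => (Ci * (t * w * cis s) * D m t s)%C)).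
        { apply ccont_mult; [apply ccont_scal, ccont_scal, ccont_cis | apply cD]. }
        rewrite CInt_scal by exact cc.
        rewrite (CInt_derive (F t)); [|apply dF|exact cc].
        unfold F. pose proof (cis_PI 1) as E. simpl INR in E. rewrite !Rmult_1_l in E. rewrite E. ring. }
    rewrite <- Z.
    (* The second derivative is bounded for [u] within 1 of [t] in [[0, 1]], hence for
       [|u| <= 2]. *)
    pose (r := 2 * Cmod w).
    pose (Bd := fun k => exp (INR k * r + Cmod x * (exp r + 1))).
    apply (cderiv_CInt_param F (fun u s => w * cis s * D m u s)%C
      (fun u s => w * cis s * (w * cis s) * (INR m * D m u s + x * D (S m) u s))%C _ _
      (Cmod w * Cmod w * (INR m * (INR m * Bd m + Cmod x * Bd (S m))
         + Cmod x * (INR (S m) * Bd (S m) + Cmod x * Bd (S (S m)))))); [exact pc | | | | |].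
    - intros u s. apply cderiv_touchard_egf, Hu.
    - intros u s.
      eapply cderiv_eq; [apply cderiv_scal, cderiv_plus; apply cderiv_scal, cderiv_touchard_egf, Hu | reflexivity |].
      unfold D; ring.
    - intros u. apply (ccont_touchard_egf_circle x m (u * w)).
    - intros u. apply ccont_mult; [apply ccont_scal, ccont_cis | apply cD].
    - intros u s Hut _.
      assert (Hc : Cmod (u * w * cis s) <= r).
      { rewrite !Cmod_mult, Cmod_cis, Cmod_R, Rmult_1_r. unfold r.
        apply Rmult_le_compat_r; [apply Cmod_ge_0|].
        unfold Rabs in *; repeat destruct Rcase_abs; lra. }
      assert (Hb : forall k, Cmod (touchard_egf x k (u * w * cis s)) <= Bd k)
        by (intros; apply Cmod_touchard_egf_le, Hc).
      assert (HD : forall k, Cmod (D k u s) <= INR k * Bd k + Cmod x * Bd (S k)).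
      { intros k. unfold D. eapply Rle_trans; [apply Cmod_triangle|].
        rewrite !Cmod_mult, Cmod_R, (Rabs_pos_eq _ (pos_INR k)).
        apply Rplus_le_compat; apply Rmult_le_compat_l; auto using pos_INR, Cmod_ge_0. }
      rewrite !(Cmod_mult (_ * _)), !(Cmod_mult w), !Cmod_cis, !Rmult_1_r.
      apply Rmult_le_compat_l; [apply Rmult_le_pos; apply Cmod_ge_0|].
      eapply Rle_trans; [apply Cmod_triangle|].
      rewrite !Cmod_mult, Cmod_R, (Rabs_pos_eq _ (pos_INR m)).
      apply Rplus_le_compat; apply Rmult_le_compat_l; auto using pos_INR, Cmod_ge_0. }
  assert (E : Cmod (CInt (F 1) (- PI) PI - CInt (F 0) (- PI) PI) <= 2 * 0 * Rabs (1 - 0)).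
  { apply (cmvt (fun u => CInt (F u) (- PI) PI) (fun _ => 0%C)). rewrite Rmin_left, Rmax_right by lra.
    intros t Ht; split; [apply dM, Ht | rewrite Cmod_0; lra]. }
  rewrite Rmult_0_r, Rmult_0_l in E.
  assert (E' : (CInt (F 1) (- PI) PI - CInt (F 0) (- PI) PI)%C = 0%C)
    by (apply Cmod_eq_0, Rle_antisym; [exact E | apply Cmod_ge_0]).
  apply Ceq_minus in E'.
  rewrite (CInt_ext _ (F 1)) by (intros s; unfold F; rewrite Cmult_1_l; reflexivity).
  rewrite E'. rewrite (CInt_ext _ (fun _ => 1%C)).
  - rewrite CInt_const, Cmult_1_l. f_equal; ring.
  - intros s. unfold F, touchard_egf. rewrite !Cmult_0_l, Cmult_0_r, Cexp_0.
    rewrite <- Cexp_0. f_equal. ring.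
Qed.

Definition shifted_touchard (n m : nat) (x : C) : C :=
  sum_n_m (fun k => INR (Combinatorics.shifted_stirling n m k) * x ^ k)%C 0 n.

Lemma shifted_touchardS (n m : nat) (x : C) :
  shifted_touchard (S n) m x = (INR m * shifted_touchard n m x + x * shifted_touchard n (S m) x)%C.
Proof.
  unfold shifted_touchard.
  assert (E : sum_n_m (fun k => INR (Combinatorics.shifted_stirling n m k) * x ^ k)%C 0 n
    = sum_n_m (fun k => INR (Combinatorics.shifted_stirling n m k) * x ^ k)%C 0 (S n)).
  { rewrite sum_n_Sm by lia. rewrite Combinatorics.shifted_stirling_small by lia.
    simpl INR. rewrite Cmult_0_l. symmetry; apply (Cplus_0_r). }
  rewrite E.
  rewrite (sum_Sn_m _ 0 (S n)), (sum_Sn_m (fun k => INR (Combinatorics.shifted_stirling n m k) * x ^ k)%C 0 (S n)) by lia.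
  rewrite <- !sum_n_m_S.
  rewrite <- (sum_n_m_mult_l (K := C_Ring) x).
  rewrite Combinatorics.shifted_stirlingS0, mult_INR, RtoC_mult.
  change plus with Cplus.
  rewrite Cmult_plus_distr_l, <- Cplus_assoc. apply (f_equal2 Cplus); [ring|].
  rewrite <- (sum_n_m_mult_l (K := C_Ring) (RtoC (INR m))).
  rewrite <- (sum_n_m_plus (G := C_AbelianMonoid)).
  apply sum_n_m_ext. intros k.
  rewrite Combinatorics.shifted_stirlingS, plus_INR, mult_INR, RtoC_plus, RtoC_mult.
  change plus with Cplus. change mult with Cmult. match goal with |- @eq _ ?a ?b => change (@eq C a b) end. simpl Cpow. ring.
Qed.

Lemma is_derive_opp_linear (a s : R) : is_derive (fun s => - (a * s)) s (- a).
Proof. auto_derive; [exact I | ring]. Qed.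

(* Cauchy's formula for the Taylor coefficients, by integration by parts in the
   angle instead of power series. *)
Lemma touchard_egf_coefficient (x w : C) (n m : nat) :
  (INR (fact n) * CInt (fun s => touchard_egf x m (w * cis s) * cis (- (INR n * s))) (- PI) PI)%C
    = (RtoC (2 * PI) * w ^ n * shifted_touchard n m x)%C.
Proof.
  revert m; induction n as [|n IH]; intros m.
  - rewrite (CInt_ext _ (fun s => touchard_egf x m (w * cis s))).
    2:{ intros s. simpl INR. rewrite Rmult_0_l, Ropp_0, cis_0. ring. }
    rewrite touchard_egf_mean. unfold shifted_touchard. rewrite sum_n_n. simpl. ring.
  - set (B := fun n m => CInt (fun s => touchard_egf x m (w * cis s) * cis (- (INR n * s)))%C (- PI) PI) in *.
    assert (ci : forall k, ccont (fun s => cis (- (INR k * s)))).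
    { intros k. apply (cderiv_ccont _ (fun s => (Ci * - INR k) * cis (- (INR k * s)))%C). intros s.
      eapply cderiv_eq; [apply cderiv_Cexp, (cderiv_scal (Ci * - INR k)%C _ _ _ (cderiv_id s)) | |].
      - intros t; unfold cis; f_equal. rewrite RtoC_opp, RtoC_mult. ring.
      - cbv beta. rewrite Cmult_1_r. f_equal. unfold cis; f_equal. rewrite RtoC_opp, RtoC_mult. ring. }
    assert (cB : forall k j, ccont (fun s => touchard_egf x j (w * cis s) * cis (- (INR k * s)))%C).
    { intros; apply ccont_mult; [apply ccont_touchard_egf_circle | apply ci]. }
    pose (b := fun k j s => (touchard_egf x j (w * cis s) * cis (- (INR k * s)))%C).
    assert (R : (w * (INR m * B n m + x * B n (S m)) - INR (S n) * B (S n) m)%C = 0%C).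
    { change B with (fun k j => CInt (b k j) (- PI) PI); cbv beta.
      assert (c1 : ccont (fun s => INR m * b n m s + x * b n (S m) s)%C).
      { apply ccont_plus; apply ccont_scal, cB. }
      transitivity (CInt (fun s => w * (INR m * b n m s + x * b n (S m) s) - INR (S n) * b (S n) m s)%C (- PI) PI).
      { rewrite (CInt_minus (fun s => w * (INR m * b n m s + x * b n (S m) s))%C (fun s => INR (S n) * b (S n) m s)%C);
          [|apply (ccont_scal w), c1 | apply ccont_scal, cB].
        rewrite (CInt_scal w _ _ _ c1), (CInt_scal _ (b (S n) m)) by apply cB.
        rewrite (CInt_plus (fun s => INR m * b n m s)%C) by (apply ccont_scal, cB).
        rewrite !CInt_scal by apply cB. reflexivity. }
      (* Differentiating the circle produces a factor [cis s], which lowers the frequency from [S n]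
         to [n]; differentiating the oscillating factor gives the term with [INR (S n)]. The
         antiderivative agrees at both endpoints. *)
      rewrite (CInt_derive (fun s => - Ci * b (S n) m s)%C).
      - unfold b. rewrite <- Ropp_mult_distr_r, Ropp_involutive.
        rewrite Ropp_mult_distr_r, <- (cis_PI (S n)).
        replace (cis (- PI)) with (cis PI); [ring|].
        pose proof (cis_PI 1) as E; simpl INR in E; rewrite !Rmult_1_l in E; exact E.
      - intros s. eapply cderiv_eq.
        + apply cderiv_scal, cderiv_mult; [apply cderiv_touchard_egf, cderiv_circle |].
          apply cderiv_Cexp, (cderiv_scal Ci), cderiv_RtoC.
          exact (is_derive_opp_linear (INR (S n)) s).
        + reflexivity.
        + cbv beta. unfold b. change (Cexp (Ci * (- (INR (S n) * s))%R)) with (cis (- (INR (S n) * s))).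
          replace (cis (- (INR n * s))) with (cis s * cis (- (INR (S n) * s)))%C
            by (rewrite <- cis_add; f_equal; rewrite S_INR; ring).
          rewrite RtoC_opp. generalize (cis (- (INR (S n) * s))) (RtoC (INR (S n))); intros e N.
          generalize (touchard_egf x m (w * cis s)) (touchard_egf x (S m) (w * cis s)); intros e1 e2.
          assert (I2 : (Ci * Ci = - 1)%C) by (apply C_ext; unfold Re, Im; simpl; ring).
          transitivity (- (Ci * Ci) * (w * cis s * (INR m * e1 + x * e2) * e - N * e1 * e))%C; [ring|].
          rewrite I2; ring.
      - apply ccont_minus; [apply (ccont_scal w), c1 | apply ccont_scal, cB]. }
    apply Ceq_minus in R.
    rewrite shifted_touchardS.
    change (fact (S n)) with (S n * fact n)%nat.
    rewrite mult_INR, RtoC_mult.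
    change (INR (S n) * INR (fact n) * B (S n) m = RtoC (2 * PI) * w ^ S n * (INR m * shifted_touchard n m x + x * shifted_touchard n (S m) x))%C.
    transitivity (INR (fact n) * (INR (S n) * B (S n) m))%C; [ring|].
    rewrite <- R.
    transitivity (w * (INR m * (INR (fact n) * B n m) + x * (INR (fact n) * B n (S m))))%C; [ring|].
    assert (IHB : forall k, (INR (fact n) * B n k = RtoC (2 * PI) * w ^ n * shifted_touchard n k x)%C) by exact IH.
    rewrite !IHB. simpl Cpow. ring.
Qed.

(** * The moment generating function as a quotient of saddle point integrals *)

Lemma Cexp_Clog (z : C) : z <> 0%C -> Cexp (Clog z) = z.
Proof.
  intros Hz. assert (Hp := proj1 (Cmod_gt_0 z) Hz).
  assert (Hc : -1 <= Re z / Cmod z <= 1).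
  { pose proof (re_le_Cmod z) as H. apply Rabs_le_between in H.
    split; [apply Rle_div_r | apply Rle_div_l]; lra. }
  assert (Hs : sqrt (1 - Rsqr (Re z / Cmod z)) = Rabs (Im z) / Cmod z).
  { rewrite <- (sqrt_Rsqr (Rabs (Im z) / Cmod z)).
    - f_equal. pose proof (Cmod2_alt z) as H.
      unfold Rsqr, Rdiv.
      apply (Rmult_eq_reg_r (Cmod z ^ 2)); [|apply pow_nonzero; lra].
      transitivity (Cmod z ^ 2 - Re z ^ 2); [field; lra|].
      transitivity (Rabs (Im z) ^ 2); [rewrite pow2_abs, H; ring | field; lra].
    - apply Rdiv_le_0_compat; [apply Rabs_pos | assumption]. }
  apply C_ext.
  - change (Re (Cexp (Clog z))) with (exp (ln (Cmod z)) * cos (Carg z)).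
    rewrite exp_ln by assumption.
    unfold Carg. destruct Rle_dec; unfold ssrbool.is_left; rewrite ?cos_neg, cos_acos by assumption; field; lra.
  - change (Im (Cexp (Clog z))) with (exp (ln (Cmod z)) * sin (Carg z)).
    rewrite exp_ln by assumption.
    unfold Carg. destruct Rle_dec; unfold ssrbool.is_left; rewrite ?sin_neg, sin_acos, Hs by assumption.
    + rewrite Rabs_pos_eq by assumption. field; lra.
    + rewrite Rabs_left by lra. field; lra.
Qed.

Lemma Carg_bound (z : C) : - PI <= Carg z <= PI.
Proof.
  unfold Carg. pose proof (acos_bound (Re z / Cmod z)). destruct Rle_dec; simpl; lra.
Qed.

Lemma Csqrt_sqr (z : C) : (Csqrt z * Csqrt z)%C = z.
Proof.
  unfold Csqrt. destruct Ceq_dec as [->|Hz]; unfold ssrbool.is_left; [ring|].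
  rewrite <- Cexp_plus. replace (Clog z / 2 + Clog z / 2)%C with (Clog z) by field.
  apply Cexp_Clog, Hz.
Qed.

(** Half of the principal argument lies in [[-PI/2, PI/2]]. Together with [Csqrt_sqr] this selects
    the root in the limit. *)
Lemma Re_Csqrt_ge_0 (z : C) : 0 <= Re (Csqrt z).
Proof.
  unfold Csqrt. destruct Ceq_dec; unfold ssrbool.is_left; [simpl; lra|].
  change (0 <= exp (Re (Clog z / 2)) * cos (Im (Clog z / 2))).
  apply Rmult_le_pos; [left; apply exp_pos|].
  pose proof (Carg_bound z).
  replace (Im (Clog z / 2)) with (Carg z / 2).
  - apply cos_ge_0; lra.
  - replace (Clog z / 2)%C with ((/ 2)%R * Clog z)%C.
    + rewrite im_scal_l. unfold Clog, Im; simpl; field.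
    + rewrite RtoC_inv by lra. field.
Qed.

Definition phase (w : C) (s : R) : C := ((Cexp (w * (cis s - 1)) - 1) / w - Ci * s)%C.

Definition saddle_integral (n : nat) (w : C) : C :=
  CInt (fun s => Cexp (INR n * phase w s)) (- PI) PI.

(* [t = w cis s] is the circle through the saddle point [w] of
   [u (exp t - 1) - log t]. *)
Lemma saddle_integral_touchard (n : nat) (u w : C) :
  (u * (w * Cexp w))%C = 1%C ->
  (INR (fact n) * saddle_integral n w)%C
    = (RtoC (2 * PI) * w ^ n * shifted_touchard n 0 (INR n * u) * Cexp (INR n * (u - / w)))%C.
Proof.
  intros Huw.
  assert (Hw : w <> 0%C) by (intros ->; apply C1_nz; rewrite <- Huw; ring).
  assert (Hu : u = (Cexp (- w) / w)%C).
  { rewrite Cexp_opp. assert (He := Cexp_neq_0 w).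
    transitivity (u * (w * Cexp w) / (w * Cexp w))%C; [field; split; assumption|].
    rewrite Huw; field; split; assumption. }
  rewrite <- touchard_egf_coefficient.
  unfold saddle_integral.
  rewrite (CInt_ext _ (fun s => Cexp (INR n * (u - / w)) *
    (touchard_egf (INR n * u) 0 (w * cis s) * cis (- (INR n * s))))%C).
  - rewrite CInt_scal; [ring|].
    apply ccont_mult; [apply ccont_touchard_egf_circle|].
    apply (cderiv_ccont _ (fun s => RtoC (- INR n) * Ci * cis (- (INR n * s)))%C); intros s.
    eapply cderiv_eq; [apply cderiv_Cexp, (cderiv_scal Ci), cderiv_RtoC, is_derive_opp_linear | reflexivity |].
    unfold cis; ring.
  - intros s. unfold touchard_egf, cis at 3, phase. rewrite <- !Cexp_plus. f_equal.
    replace (w * (cis s - 1))%C with (w * cis s + - w)%C by ring.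
    rewrite Cexp_plus, Hu. simpl INR at 3. rewrite RtoC_opp, RtoC_mult.
    field; assumption.
Qed.

Lemma shifted_touchard_pos (n : nat) (x : C) : (1 <= n)%nat ->
  shifted_touchard n 0 x = sum_n_m (fun k => INR (stirling2 n k) * x ^ k)%C 1 n.
Proof.
  intros Hn. unfold shifted_touchard. rewrite sum_Sn_m by lia.
  destruct n as [|n]; [lia|].
  rewrite Combinatorics.shifted_stirlingS0. simpl INR at 1.
  rewrite Cmult_0_l. change plus with Cplus. rewrite Cplus_0_l.
  apply sum_n_m_ext_loc. intros k Hk.
  rewrite Combinatorics.stirling2_shifted by lia. reflexivity.
Qed.

Lemma RtoC_sum_n_m (a : nat -> R) (m n : nat) :
  RtoC (sum_n_m a m n) = sum_n_m (fun k => RtoC (a k)) m n.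
Proof.
  destruct (Nat.lt_ge_cases n m) as [H|H].
  - rewrite !sum_n_m_zero by assumption. reflexivity.
  - induction H as [|n H IH].
    + rewrite !sum_n_n; reflexivity.
    + rewrite !sum_n_Sm by lia. rewrite <- IH. apply RtoC_plus.
Qed.

Lemma RtoC_touchard (n : nat) (x : R) : (1 <= n)%nat ->
  RtoC (touchard n x) = shifted_touchard n 0 x.
Proof.
  intros Hn. rewrite shifted_touchard_pos by assumption. unfold touchard.
  rewrite RtoC_sum_n_m. apply sum_n_m_ext. intros k. rewrite RtoC_mult, RtoC_pow. reflexivity.
Qed.

Lemma expectation_X2 (n : nat) (theta : R) (z : C) : (1 <= n)%nat -> touchard n theta <> 0 ->
  expectation n (X2_pmf n theta) (fun k => Cexp (z * INR k))
    = (shifted_touchard n 0 (theta * Cexp z) / shifted_touchard n 0 theta)%C.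
Proof.
  intros Hn HT. rewrite <- RtoC_touchard, shifted_touchard_pos by assumption.
  unfold Cdiv. rewrite Cmult_comm, <- (sum_n_m_mult_l (K := C_Ring)).
  apply sum_n_m_ext. intros k. unfold X2_pmf, Rdiv.
  rewrite !RtoC_mult, RtoC_inv, RtoC_pow by assumption.
  rewrite (Cmult_comm z), Cexp_INR, Cpow_mult_l.
  change mult with Cmult. match goal with |- @eq _ ?a ?b => change (@eq C a b) end. ring.
Qed.

(** The logarithm enters only through [exp (n log u) = u^n], valid for integer [n] whatever the
    branch. The saddle equation then turns [(exp w * u)^n] into [w^(-n)]. *)
Lemma Cexp_L2 (W0 : C -> C) (n : nat) (u w : C) :
  W0 (/ u)%C = w -> (u * (w * Cexp w))%C = 1%C ->
  Cexp (INR n * L2 W0 u) = (/ (w ^ n * Cexp (INR n * (u - / w))))%C.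
Proof.
  intros Hw Huw.
  assert (Hw0 : w <> 0%C) by (intros E; apply C1_nz; rewrite <- Huw, E; ring).
  assert (Hu0 : u <> 0%C) by (intros E; apply C1_nz; rewrite <- Huw, E; ring).
  unfold L2. rewrite Hw.
  replace (INR n * (w + / w - u + Clog u))%C with
    (- (INR n * (u - / w)) + INR n * (w + Clog u))%C by ring.
  rewrite Cexp_plus, Cexp_opp, (Cexp_INR n (w + _)), Cexp_plus, Cexp_Clog by assumption.
  replace (Cexp w * u)%C with (/ w)%C.
  - rewrite Cpow_inv by assumption.
    field. split; [apply Cexp_neq_0 | apply Cpow_nz; assumption].
  - transitivity (u * (w * Cexp w) / w)%C; [rewrite Huw; field; assumption | field; assumption].
Qed.

Lemma mgf_ratio_saddle (W0 : C -> C) (vartheta : R) (n : nat) (z w w1 : C) :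
  (1 <= n)%nat ->
  W0 (/ (vartheta * Cexp z))%C = w -> (vartheta * Cexp z * (w * Cexp w))%C = 1%C ->
  W0 (/ vartheta)%C = w1 -> (vartheta * (w1 * Cexp w1))%C = 1%C ->
  saddle_integral n w1 <> 0%C ->
  mgf_ratio W0 vartheta n z = (saddle_integral n w / saddle_integral n w1)%C.
Proof.
  intros Hn Hw Hu Hw1 Hu1 HJ.
  pose proof (saddle_integral_touchard n _ _ Hu) as E.
  pose proof (saddle_integral_touchard n _ _ Hu1) as E1.
  assert (Hf : RtoC (INR (fact n)) <> 0%C).
  { intros H. apply (INR_fact_neq_0 n), RtoC_inj, H. }
  (* The normalising Touchard value is a factor of the nonzero integral at [w1]. *)
  assert (HT : shifted_touchard n 0 (INR n * vartheta) <> 0%C).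
  { intros H. rewrite H, Cmult_0_r, Cmult_0_l in E1. revert E1. apply Cmult_neq_0; assumption. }
  assert (Hw0 : w <> 0%C) by (intros H; apply C1_nz; rewrite <- Hu, H; ring).
  assert (Hw10 : w1 <> 0%C) by (intros H; apply C1_nz; rewrite <- Hu1, H; ring).
  assert (Hpi : RtoC (2 * PI) <> 0%C).
  { intros H. apply RtoC_inj in H. pose proof PI_RGT_0; lra. }
  unfold mgf_ratio. rewrite expectation_X2; [|assumption|].
  2:{ intros H. apply HT. rewrite <- RtoC_mult, <- RtoC_touchard, Rmult_comm, H by assumption. reflexivity. }
  unfold phi2.
  replace (INR n * (L2 W0 (vartheta * Cexp z) - L2 W0 vartheta))%C with
    (INR n * L2 W0 (vartheta * Cexp z) + - (INR n * L2 W0 vartheta))%C by ring.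
  rewrite Cexp_plus, Cexp_opp, (Cexp_L2 _ _ _ _ Hw Hu), (Cexp_L2 _ _ _ _ Hw1 Hu1).
  replace (RtoC (vartheta * INR n) * Cexp z)%C with (INR n * (vartheta * Cexp z))%C by (rewrite RtoC_mult; ring).
  replace (RtoC (vartheta * INR n)) with (INR n * vartheta)%C by (rewrite RtoC_mult; ring).
  replace (saddle_integral n w / saddle_integral n w1)%C with
    ((INR (fact n) * saddle_integral n w) / (INR (fact n) * saddle_integral n w1))%C by (field; split; assumption).
  rewrite E, E1.
  assert (P := Cpow_nz w n Hw0). assert (P1 := Cpow_nz w1 n Hw10).
  assert (X := Cexp_neq_0 (INR n * (vartheta * Cexp z - / w))). assert (X1 := Cexp_neq_0 (INR n * (vartheta - / w1))).
  revert HT Hpi P P1 X X1.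
  generalize (shifted_touchard n 0 (INR n * vartheta)) (shifted_touchard n 0 (INR n * (vartheta * Cexp z)))
    (w ^ n)%C (w1 ^ n)%C (Cexp (INR n * (vartheta * Cexp z - / w))) (Cexp (INR n * (vartheta - / w1))) (RtoC (2 * PI)).
  intros. field. repeat split; assumption.
Qed.

(** * Gaussian integrals on [-PI, PI] *)

(** Half of the exponential decay pays for the power: [y <= 2 j exp (y / (2 j))], raised to the
    power [j]. The division by [j] is why [j = 0] is separate. *)
Lemma pow_exp_opp_le (j : nat) (y : R) : 0 <= y ->
  y ^ j * exp (- y) <= (2 * INR j) ^ j * exp (- (y / 2)).
Proof.
  intros Hy. destruct (Nat.eq_dec j 0) as [->|Hj].
  - simpl. rewrite !Rmult_1_l. apply exp_monotone; lra.
  - assert (Hp : 0 < 2 * INR j) by (pose proof (lt_0_INR j ltac:(lia)); lra).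
    assert (H : y ^ j <= (2 * INR j) ^ j * exp (y / 2)).
    { replace (exp (y / 2)) with (exp (y / (2 * INR j)) ^ j).
      - rewrite <- Rpow_mult_distr. apply pow_incr. split; [assumption|].
        pose proof (exp_ineq1_le (y / (2 * INR j))) as E.
        apply (Rmult_le_compat_l (2 * INR j)) in E; [|lra].
        replace (2 * INR j * (1 + y / (2 * INR j))) with (2 * INR j + y) in E by (field; lra).
        lra.
      - rewrite <- Rpower_pow by apply exp_pos. unfold Rpower. rewrite ln_exp. f_equal. field; lra. }
    replace (exp (- (y / 2))) with (exp (y / 2) * exp (- y)) by (rewrite <- exp_plus; f_equal; field).
    rewrite <- Rmult_assoc. apply Rmult_le_compat_r; [left; apply exp_pos | exact H].
Qed.

Lemma continuous_monomial_exp (j : nat) (q : R) (t : R) : continuous (fun s => s ^ j * exp (- (q * s ^ 2))) t.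
Proof.
  apply (ex_derive_continuous (K := R_AbsRing) (V := R_NormedModule)). auto_derive; exact I.
Qed.

(** Compares [exp (- x)] with [1 / (1 + x)], whose integral is an arctangent of total variation at
    most [PI <= 4]. *)
Lemma gauss_le (q : R) : 0 < q -> RInt (fun s => exp (- (q * s ^ 2))) (- PI) PI <= 4 / sqrt q.
Proof.
  intros Hq. assert (Hr := sqrt_lt_R0 _ Hq).
  assert (pc : - PI <= PI) by (pose proof PI_RGT_0; lra).
  assert (D : forall s, is_derive (fun s => atan (sqrt q * s) / sqrt q) s (/ (1 + q * s ^ 2))).
  { intros s. auto_derive; [exact I|].
    rewrite <- (sqrt_sqrt q) at 5 by lra. field. split; nra. }
  assert (C : forall s, continuous (fun s => / (1 + q * s ^ 2)) s).
  { intros s. apply (ex_derive_continuous (K := R_AbsRing) (V := R_NormedModule)). auto_derive. nra. }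
  apply Rle_trans with (RInt (fun s => / (1 + q * s ^ 2)) (- PI) PI).
  - apply RInt_le; [exact pc | | apply ex_RInt_cont, C |].
    + apply ex_RInt_cont. intros t. eapply continuous_ext; [|apply (continuous_monomial_exp 0 q)].
      intros s; simpl; ring.
    + intros s _. rewrite exp_Ropp. apply Rinv_le_contravar; [nra | apply exp_ineq1_le].
  - rewrite (is_RInt_unique _ _ _ _ (is_RInt_derive (V := R_CompleteNormedModule) _ _ (- PI) PI (fun s _ => D s) (fun s _ => C s))).
    unfold minus, plus, opp; simpl.
    pose proof (atan_bound (sqrt q * PI)). pose proof (atan_bound (sqrt q * - PI)). pose proof PI_4.
    unfold Rdiv. rewrite <- Ropp_mult_distr_l_reverse, <- Rmult_plus_distr_r.
    apply Rmult_le_compat_r; [left; apply Rinv_0_lt_compat, Hr | lra].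
Qed.

(** The power is absorbed at the price of halving [q] in the exponent; this turns the constant 4
    into 8 because [sqrt q <= 2 sqrt (q / 2)]. *)
Lemma gauss_moment_le (j : nat) (q : R) : 0 < q ->
  RInt (fun s => s ^ (2 * j) * exp (- (q * s ^ 2))) (- PI) PI
    <= 8 * (2 * INR j) ^ j / (q ^ j * sqrt q).
Proof.
  intros Hq. assert (Hr := sqrt_lt_R0 _ Hq).
  assert (pc : - PI <= PI) by (pose proof PI_RGT_0; lra).
  assert (Hqj : 0 < q ^ j) by (apply pow_lt; assumption).
  assert (HJ : 0 <= (2 * INR j) ^ j) by (apply pow_le; pose proof (pos_INR j); lra).
  assert (C : forall t, continuous (fun s => exp (- (q / 2 * s ^ 2))) t).
  { intros t. eapply continuous_ext; [|apply (continuous_monomial_exp 0 (q / 2))]. intros s; simpl; ring. }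
  apply Rle_trans with (RInt (fun s => (2 * INR j) ^ j / q ^ j * exp (- (q / 2 * s ^ 2))) (- PI) PI).
  - apply RInt_le; [exact pc | apply ex_RInt_cont, continuous_monomial_exp | |].
    + apply (ex_RInt_scal (V := R_NormedModule)), ex_RInt_cont, C.
    + intros s _. rewrite pow_mult.
      pose proof (pow_exp_opp_le j (q * s ^ 2) ltac:(nra)) as H.
      rewrite Rpow_mult_distr in H.
      replace (q * s ^ 2 / 2) with (q / 2 * s ^ 2) in H by field.
      apply (Rmult_le_reg_l (q ^ j)); [assumption|].
      eapply Rle_trans; [|eapply Rle_trans; [exact H|]]; right; field; lra.
  - pose proof (RInt_scal (V := R_CompleteNormedModule) (fun s => exp (- (q / 2 * s ^ 2))) (- PI) PI ((2 * INR j) ^ j / q ^ j)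
      (ex_RInt_cont _ _ _ C)) as E.
    change (RInt (fun s => (2 * INR j) ^ j / q ^ j * exp (- (q / 2 * s ^ 2))) (- PI) PI
      = (2 * INR j) ^ j / q ^ j * RInt (fun s => exp (- (q / 2 * s ^ 2))) (- PI) PI) in E.
    rewrite E.
    replace (8 * (2 * INR j) ^ j / (q ^ j * sqrt q)) with ((2 * INR j) ^ j / q ^ j * (8 / sqrt q)) by (field; lra).
    apply Rmult_le_compat_l; [apply Rdiv_le_0_compat; assumption|].
    eapply Rle_trans; [apply gauss_le; lra|].
    assert (H2 : 0 < sqrt (q / 2)) by (apply sqrt_lt_R0; lra).
    assert (Hle : sqrt q <= 2 * sqrt (q / 2)).
    { apply Rsqr_incr_0_var; [|lra]. unfold Rsqr.
      replace (2 * sqrt (q / 2) * (2 * sqrt (q / 2))) with (4 * (sqrt (q / 2) * sqrt (q / 2))) by ring.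
      rewrite !sqrt_sqrt by lra. lra. }
    apply (Rmult_le_reg_r (sqrt q * sqrt (q / 2))); [apply Rmult_lt_0_compat; assumption|].
    replace (4 / sqrt (q / 2) * (sqrt q * sqrt (q / 2))) with (4 * sqrt q) by (field; lra).
    replace (8 / sqrt q * (sqrt q * sqrt (q / 2))) with (8 * sqrt (q / 2)) by (field; lra). lra.
Qed.

(** * Gaussian integrals with a complex parameter *)

Definition gauss (b : C) (s : R) : C := Cexp (- (b * RtoC (s ^ 2 / 2))).

Definition gauss_integral (b : C) : C := CInt (gauss b) (- PI) PI.

Lemma is_derive_sqr (s : R) : is_derive (fun s => s ^ 2) s (2 * s).
Proof. auto_derive; [exact I | ring]. Qed.

Lemma is_derive_half_sqr (s : R) : is_derive (fun s => s ^ 2 / 2) s s.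
Proof. auto_derive; [exact I | field]. Qed.

Lemma cderiv_gauss (b : C) (s : R) : cderiv (gauss b) s (- (b * s) * gauss b s)%C.
Proof.
  assert (E : forall t : R, (- b * RtoC (t ^ 2 / 2))%C = (- (b * RtoC (t ^ 2 / 2)))%C) by (intros; ring).
  unfold gauss. eapply cderiv_eq;
    [apply cderiv_Cexp, (cderiv_scal (- b)%C _ _ _ (cderiv_RtoC _ _ _ (is_derive_half_sqr s))) | |].
  - intros t. cbv beta. rewrite E. reflexivity.
  - cbv beta. rewrite E. ring.
Qed.

Lemma ccont_gauss b : ccont (gauss b).
Proof. exact (cderiv_ccont _ _ (cderiv_gauss b)). Qed.

Lemma ccont_RtoC (f f' : R -> R) : (forall t, is_derive f t (f' t)) -> ccont (fun s => RtoC (f s)).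
Proof. intros H. apply (cderiv_ccont _ (fun t => RtoC (f' t))). intros; apply cderiv_RtoC, H. Qed.

Lemma ccont_pow (j : nat) : ccont (fun s => RtoC (s ^ j)).
Proof.
  apply (ccont_RtoC _ (fun s => INR j * s ^ pred j)). intros t. auto_derive; [exact I | ring].
Qed.

Lemma Cmod_gauss (b : C) (s : R) : Cmod (gauss b s) = exp (- (Re b / 2 * s ^ 2)).
Proof.
  unfold gauss. rewrite Cmod_Cexp. f_equal.
  unfold Cmult, Copp, RtoC, Re; simpl; field.
Qed.

Lemma gauss_integral_real (b : R) :
  gauss_integral b = RtoC (RInt (fun s => exp (- (b / 2 * s ^ 2))) (- PI) PI).
Proof.
  assert (E : forall s, gauss b s = RtoC (exp (- (b / 2 * s ^ 2)))).
  { intros s. unfold gauss. rewrite <- Cexp_RtoC. f_equal. rewrite <- RtoC_mult, <- RtoC_opp. f_equal. field. }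
  apply C_ext.
  - change (RInt (fun s => Re (gauss b s)) (- PI) PI = RInt (fun s => exp (- (b / 2 * s ^ 2))) (- PI) PI).
    apply RInt_ext. intros s _. rewrite E. reflexivity.
  - change (RInt (fun s => Im (gauss b s)) (- PI) PI = 0).
    rewrite (RInt_ext _ (fun _ => 0)).
    + rewrite RInt_const. unfold scal; simpl; unfold mult; simpl; ring.
    + intros s _. rewrite E. reflexivity.
Qed.

(** The odd integrand has an explicit even antiderivative, which takes the same value at both
    endpoints. *)
Lemma gauss_cubic_moment (b : C) : b <> 0%C ->
  CInt (fun s => gauss b s * RtoC (s ^ 3))%C (- PI) PI = 0%C.
Proof.
  intros Hb.
  rewrite (CInt_derive (fun s => (- / b * RtoC (s ^ 2) - 2 / (b * b)) * gauss b s)%C).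
  - unfold gauss. replace ((- PI) ^ 2) with (PI ^ 2) by ring. ring.
  - intros s. eapply cderiv_eq.
    + apply cderiv_mult; [apply cderiv_minus; [apply cderiv_scal, cderiv_RtoC, is_derive_sqr | apply cderiv_const] | apply cderiv_gauss].
    + reflexivity.
    + cbv beta. rewrite RtoC_mult, !RtoC_pow. field. assumption.
  - apply ccont_mult; [apply ccont_gauss | apply ccont_pow].
Qed.

(** Only [|s| <= 1 / sqrt n] is kept, where the integrand is at least [exp (- a / 2)]. *)
Lemma gauss_integral_real_ge (a : R) (n : nat) : (1 <= n)%nat -> 0 < a ->
  2 * exp (- (a / 2)) / sqrt (INR n) <= Re (gauss_integral (INR n * a)).
Proof.
  intros Hn Ha.
  assert (Hn1 : 1 <= INR n) by (apply (le_INR 1), Hn).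
  assert (Hs : 1 <= sqrt (INR n)) by (rewrite <- sqrt_1; apply sqrt_le_1_alt; assumption).
  set (r := / sqrt (INR n)).
  assert (Hr : 0 < r <= 1).
  { unfold r. split; [apply Rinv_0_lt_compat; lra|]. rewrite <- Rinv_1. apply Rinv_le_contravar; lra. }
  assert (Hr2 : INR n * r ^ 2 = 1).
  { unfold r. rewrite <- (sqrt_sqrt (INR n)) at 1 by lra. field; lra. }
  pose proof PI_RGT_0. pose proof PI2_1.
  rewrite <- RtoC_mult, gauss_integral_real, re_RtoC.
  set (f := fun s => exp (- (INR n * a / 2 * s ^ 2))).
  assert (C : forall t, continuous f t).
  { intros t. eapply continuous_ext; [|apply (continuous_monomial_exp 0 (INR n * a / 2))]. intros s; unfold f; simpl; ring. }
  assert (X : forall x y, ex_RInt f x y) by (intros; apply ex_RInt_cont, C).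
  assert (P : forall x y, x <= y -> 0 <= RInt f x y).
  { intros x y Hxy. apply RInt_ge_0; [assumption | apply X | intros; left; apply exp_pos]. }
  pose proof (RInt_Chasles (V := R_CompleteNormedModule) f (- PI) (- r) PI (X _ _) (X _ _)) as E1.
  pose proof (RInt_Chasles (V := R_CompleteNormedModule) f (- r) r PI (X _ _) (X _ _)) as E2.
  change (RInt f (- PI) (- r) + RInt f (- r) PI = RInt f (- PI) PI) in E1.
  change (RInt f (- r) r + RInt f r PI = RInt f (- r) PI) in E2.
  pose proof (P (- PI) (- r) ltac:(lra)). pose proof (P r PI ltac:(lra)).
  assert (2 * exp (- (a / 2)) / sqrt (INR n) <= RInt f (- r) r).
  { apply Rle_trans with (RInt (fun _ => exp (- (a / 2))) (- r) r).
    - rewrite RInt_const. unfold scal; simpl; unfold mult; simpl. right. unfold r. field. lra.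
    - apply RInt_le; [lra | apply ex_RInt_const | apply X |].
      intros s Hs'. apply exp_monotone. apply Ropp_le_contravar.
      assert (INR n * s ^ 2 <= 1) by (rewrite <- Hr2; apply Rmult_le_compat_l; nra). nra. }
  lra.
Qed.

Lemma INR_ge_1 (n : nat) : (1 <= n)%nat -> 1 <= INR n.
Proof. intros H; apply (le_INR 1), H. Qed.

(** The exponents differ by [n (a - a0) s^2 / 2], and the second moment is [O(n^(-3/2))]. The change
    is thus [O(|a - a0| / sqrt n)], the order of the integral itself, with a constant free of
    [n]. *)
Lemma gauss_integral_lipschitz (a0 : R) (a : C) (n : nat) : (1 <= n)%nat -> 0 < a0 -> Cmod (a - a0) <= a0 / 2 ->
  Cmod (gauss_integral (INR n * a) - gauss_integral (INR n * a0))
    <= 32 / (a0 / 4 * sqrt (a0 / 4)) * Cmod (a - a0) / sqrt (INR n).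
Proof.
  intros Hn Ha0 Ha. assert (Hn1 := INR_ge_1 n Hn).
  assert (pc : - PI <= PI) by (pose proof PI_RGT_0; lra).
  (* Common decay rate of both Gaussians, from [Re a >= a0 / 2] and the 1/2 in the exponent. *)
  set (q := INR n * (a0 / 4)). assert (Hq : 0 < q) by (unfold q; nra).
  assert (HRe : a0 / 2 <= Re a).
  { pose proof (Re_ge_opp_Cmod (a - a0)) as H. unfold Cminus, Cplus, Copp, RtoC, Re in *; simpl in *. lra. }
  unfold gauss_integral. rewrite <- CInt_minus by apply ccont_gauss.
  eapply Rle_trans; [apply (Cmod_CInt_le _ (fun s => INR n * Cmod (a - a0) * (s ^ (2 * 1) * exp (- (q * s ^ 2)))) _ _ pc)|].
  - apply ccont_minus; apply ccont_gauss.
  - intros t. apply (continuous_scal_r (V := R_NormedModule) (INR n * Cmod (a - a0))), continuous_monomial_exp.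
  - intros s _. unfold gauss.
    eapply Rle_trans; [apply (Cexp_lipschitz _ _ (- (q * s ^ 2)))|].
    + unfold q, Cmult, Copp, RtoC, Re in *; simpl in *.
      assert (0 <= INR n * (s * s) * (fst a - a0 / 2)) by (apply Rmult_le_pos; nra). nra.
    + unfold q, Cmult, Copp, RtoC, Re in *; simpl in *.
      assert (0 <= INR n * (s * s) * a0) by (apply Rmult_le_pos; nra). nra.
    + replace (- (INR n * a * RtoC (s ^ 2 / 2)) - - (INR n * a0 * RtoC (s ^ 2 / 2)))%C
        with (- (INR n * (a - a0) * RtoC (s ^ 2 / 2)))%C by ring.
      rewrite Cmod_opp, !Cmod_mult, !Cmod_R, !Rabs_pos_eq by nra. right; simpl; field.
  - pose proof (RInt_scal (V := R_CompleteNormedModule) (fun s => s ^ (2 * 1) * exp (- (q * s ^ 2))) (- PI) PI (INR n * Cmod (a - a0))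
      (ex_RInt_cont _ _ _ (continuous_monomial_exp (2 * 1) q))) as E.
    change (RInt (fun s => INR n * Cmod (a - a0) * (s ^ (2 * 1) * exp (- (q * s ^ 2)))) (- PI) PI
      = INR n * Cmod (a - a0) * RInt (fun s => s ^ (2 * 1) * exp (- (q * s ^ 2))) (- PI) PI) in E.
    rewrite E.
    pose proof (gauss_moment_le 1 q Hq) as B.
    assert (0 <= INR n * Cmod (a - a0)) by (apply Rmult_le_pos; [lra | apply Cmod_ge_0]).
    assert (Hs : sqrt q = sqrt (INR n) * sqrt (a0 / 4)) by (apply sqrt_mult; lra).
    assert (0 < sqrt (INR n)) by (apply sqrt_lt_R0; lra).
    assert (0 < sqrt (a0 / 4)) by (apply sqrt_lt_R0; lra).
    apply Rle_trans with (2 * (INR n * Cmod (a - a0) * (8 * (2 * INR 1) ^ 1 / (q ^ 1 * sqrt q)))); [nra|].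
    rewrite Hs. unfold q. right. simpl. field. repeat split; lra.
Qed.

(** The real lower bound is [2 exp (- a0 / 2) / sqrt n]; [delta] is chosen so that the Lipschitz
    error takes away at most half of it, for every [n]. *)
Lemma gauss_integral_Re_ge (a0 : R) : 0 < a0 -> exists delta c : R, 0 < delta /\ 0 < c /\
  forall (n : nat) (a : C), (1 <= n)%nat -> Cmod (a - a0) <= delta ->
    c / sqrt (INR n) <= Re (gauss_integral (INR n * a)).
Proof.
  intros Ha0.
  assert (Hs : 0 < sqrt (a0 / 4)) by (apply sqrt_lt_R0; lra).
  set (L := 32 / (a0 / 4 * sqrt (a0 / 4))).
  assert (HL : 0 < L) by (unfold L; apply Rdiv_lt_0_compat; nra).
  pose proof (exp_pos (- (a0 / 2))) as He.
  exists (Rmin (a0 / 2) (exp (- (a0 / 2)) / L)), (exp (- (a0 / 2))).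
  assert (0 < exp (- (a0 / 2)) / L) by (apply Rdiv_lt_0_compat; assumption).
  split; [apply Rmin_pos; lra | split; [assumption|]].
  intros n a Hn Ha. assert (Hn1 := INR_ge_1 n Hn).
  assert (Hrn : 0 < sqrt (INR n)) by (apply sqrt_lt_R0; lra).
  assert (Ha1 : Cmod (a - a0) <= a0 / 2) by (eapply Rle_trans; [exact Ha | apply Rmin_l]).
  assert (Ha2 : Cmod (a - a0) <= exp (- (a0 / 2)) / L) by (eapply Rle_trans; [exact Ha | apply Rmin_r]).
  pose proof (gauss_integral_lipschitz a0 a n Hn Ha0 Ha1) as B. fold L in B.
  pose proof (gauss_integral_real_ge a0 n Hn Ha0) as B0.
  pose proof (Re_ge_opp_Cmod (gauss_integral (INR n * a) - gauss_integral (INR n * a0))) as B1.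
  replace (Re (gauss_integral (INR n * a) - gauss_integral (INR n * a0))) with
    (Re (gauss_integral (INR n * a)) - Re (gauss_integral (INR n * a0))) in B1 by reflexivity.
  assert (L * Cmod (a - a0) / sqrt (INR n) <= exp (- (a0 / 2)) / sqrt (INR n)).
  { apply Rmult_le_compat_r; [left; apply Rinv_0_lt_compat; assumption|].
    apply (Rmult_le_compat_l L) in Ha2; [|lra].
    replace (L * (exp (- (a0 / 2)) / L)) with (exp (- (a0 / 2))) in Ha2 by (field; lra). exact Ha2. }
  unfold Rdiv in *. lra.
Qed.

(** Integrates the derivative of [s exp (- b s^2 / 2)]; the boundary term is kept exactly. *)
Lemma gauss_second_moment (b : C) :
  (b * CInt (fun s => RtoC (s ^ 2) * gauss b s) (- PI) PI)%C
    = (gauss_integral b - RtoC (2 * PI) * gauss b PI)%C.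
Proof.
  unfold gauss_integral.
  assert (c2 : ccont (fun s => RtoC (s ^ 2) * gauss b s)%C) by (apply ccont_mult; [apply ccont_pow | apply ccont_gauss]).
  assert (E : CInt (fun s => gauss b s - b * (RtoC (s ^ 2) * gauss b s))%C (- PI) PI = (RtoC (2 * PI) * gauss b PI)%C).
  { rewrite (CInt_derive (fun s => s * gauss b s)%C).
    - replace (gauss b (- PI)) with (gauss b PI) by (unfold gauss; do 2 f_equal; f_equal; f_equal; field).
      rewrite RtoC_opp, RtoC_mult. ring.
    - intros s. eapply cderiv_eq; [apply (cderiv_mult _ _ _ _ _ (cderiv_id s) (cderiv_gauss b s)) | reflexivity |].
      rewrite RtoC_pow. simpl; ring.
    - apply ccont_minus; [apply ccont_gauss | apply ccont_scal, c2]. }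
  rewrite <- E, CInt_minus, CInt_scal; [ring | assumption | apply ccont_gauss | apply ccont_scal, c2].
Qed.

Lemma Cmod_gauss_integral_le (b : C) : 0 <= Re b -> Cmod (gauss_integral b) <= 4 * PI.
Proof.
  intros Hb. pose proof PI_RGT_0.
  eapply Rle_trans; [apply (Cmod_CInt_le _ (fun _ => 1)); [lra | apply ccont_gauss | intros; apply continuous_const |]|].
  - intros s _. rewrite Cmod_gauss, <- exp_0. apply exp_monotone. nra.
  - rewrite RInt_const. unfold scal; simpl; unfold mult; simpl. lra.
Qed.

Lemma cderiv_gauss_integral (b d : C) (t : R) :
  cderiv (fun t : R => gauss_integral (b + t * d)) t
    (- (d / 2) * CInt (fun s => RtoC (s ^ 2) * gauss (b + t * d) s) (- PI) PI)%C.
Proof.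
  assert (pc : - PI <= PI) by (pose proof PI_RGT_0; lra).
  assert (D : forall u s : R, cderiv (fun u : R => gauss (b + u * d) s) u (- (d / 2) * RtoC (s ^ 2) * gauss (b + u * d) s)%C).
  { intros u s. unfold gauss.
    eapply cderiv_eq; [apply cderiv_Cexp, (cderiv_plus _ _ _ _ _ (cderiv_const (- (b * RtoC (s ^ 2 / 2)))%C u)
      (cderiv_scal (- (d * RtoC (s ^ 2 / 2)))%C _ _ _ (cderiv_id u))) | |].
    - intros v; cbv beta; f_equal; ring.
    - cbv beta. f_equal; [|f_equal; ring]. unfold Rdiv. rewrite RtoC_mult, RtoC_inv by lra. field. }
  assert (c2 : forall b', ccont (fun s => RtoC (s ^ 2) * gauss b' s)%C)
    by (intros; apply ccont_mult; [apply ccont_pow | apply ccont_gauss]).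
  rewrite <- CInt_scal by apply c2.
  (* Here 16 bounds [s^2], as [PI <= 4]; the 8 in the exponent below bounds [s^2 / 2]. *)
  pose (K := Cmod d / 2 * 16).
  pose proof (cderiv_CInt_param (fun u s => gauss (b + RtoC u * d) s)
    (fun u s => - (d / 2) * (RtoC (s ^ 2) * gauss (b + RtoC u * d) s))%C
    (fun u s => - (d / 2) * RtoC (s ^ 2) * (- (d / 2) * RtoC (s ^ 2) * gauss (b + RtoC u * d) s))%C
    (- PI) PI (K * (K * exp ((Cmod b + (Rabs t + 1) * Cmod d) * 8))) t pc) as P.
  apply P; clear P.
  - intros u s. eapply cderiv_eq; [apply D | reflexivity | ring].
  - intros u s. eapply cderiv_eq; [apply (cderiv_scal (- (d / 2) * RtoC (s ^ 2))%C), D | | reflexivity].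
    intros v; cbv beta; ring.
  - intros u. apply ccont_gauss.
  - intros u. apply (ccont_scal (- (d / 2))%C), c2.
  - intros u s Hu Hs.
    assert (Hs2 : s ^ 2 <= 16) by (pose proof PI_4; nra).
    assert (A : Cmod (- (d / 2) * RtoC (s ^ 2)) <= K).
    { assert (H2 : RtoC 2 <> 0%C) by (intros E; apply RtoC_inj in E; lra).
      unfold K. rewrite Cmod_mult, Cmod_opp, Cmod_div, !Cmod_R by exact H2.
      rewrite (Rabs_pos_eq 2), (Rabs_pos_eq (s ^ 2)) by nra.
      apply Rmult_le_compat_l; [|assumption]. pose proof (Cmod_ge_0 d). lra. }
    rewrite Cmod_mult, (Cmod_mult (- (d / 2) * _)).
    assert (G : Cmod (gauss (b + u * d) s) <= exp ((Cmod b + (Rabs t + 1) * Cmod d) * 8)).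
    { rewrite Cmod_gauss. apply exp_monotone.
      assert (N : Cmod (b + u * d) <= Cmod b + (Rabs t + 1) * Cmod d).
      { eapply Rle_trans; [apply Cmod_triangle|]. rewrite Cmod_mult, Cmod_R.
        apply Rplus_le_compat_l, Rmult_le_compat_r; [apply Cmod_ge_0|].
        unfold Rabs in *; repeat destruct Rcase_abs; lra. }
      pose proof (Re_ge_opp_Cmod (b + u * d)). pose proof (Cmod_ge_0 (b + u * d)).
      replace (- (Re (b + u * d) / 2 * s ^ 2)) with (- Re (b + u * d) * (s ^ 2 / 2)) by field.
      assert (0 <= s ^ 2) by nra. nra. }
    apply Rmult_le_compat; auto using Cmod_ge_0.
    + apply Rmult_le_pos; apply Cmod_ge_0.
    + apply Rmult_le_compat; auto using Cmod_ge_0.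
Qed.

(* On the whole line [b * G(b)^2] is constant (it is [2 PI]); on [-PI, PI] its
   derivative is a boundary term, exponentially small in [Re b]. *)
Lemma gauss_integral_square (a a1 : C) (lo : R) (n : nat) : (1 <= n)%nat -> 0 < lo ->
  lo <= Re a -> lo <= Re a1 ->
  Cmod (a * (gauss_integral (INR n * a) * gauss_integral (INR n * a))
        - a1 * (gauss_integral (INR n * a1) * gauss_integral (INR n * a1)))
    <= 1024 / (lo ^ 2 * PI ^ 2) * Cmod (a - a1) / INR n ^ 2.
Proof.
  intros Hn Hlo Ha Ha1. assert (Hn1 := INR_ge_1 n Hn). pose proof PI_RGT_0 as Hpi.
  set (d := (INR n * (a - a1))%C).
  pose (b := fun t : R => (INR n * a1 + t * d)%C).
  pose (G := fun t : R => gauss_integral (b t)).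
  (* The product rule gives [d G (G - b M)] with [M] the second moment, and [G - b M] is the
     boundary term of [gauss_second_moment]. *)
  assert (D : forall t, cderiv (fun t => b t * (G t * G t))%C t (d * G t * (RtoC (2 * PI) * gauss (b t) PI))%C).
  { intros t. pose proof (cderiv_gauss_integral (INR n * a1) d t) as DG.
    eapply cderiv_eq; [apply cderiv_mult; [|apply cderiv_mult; exact DG] | reflexivity |].
    - apply (cderiv_plus _ _ _ _ _ (cderiv_const _ t) (cderiv_mult _ _ _ _ _ (cderiv_id t) (cderiv_const d t))).
    - cbv beta. pose proof (gauss_second_moment (b t)) as E.
      change (gauss_integral (INR n * a1 + RtoC t * d)) with (G t). fold (b t).
      change (gauss_integral (b t)) with (G t) in E.
      set (M := CInt (fun s => RtoC (s ^ 2) * gauss (b t) s)%C (- PI) PI) in *.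
      replace (RtoC (2 * PI) * gauss (b t) PI)%C with (G t - b t * M)%C by (rewrite E; ring).
      field. }
  assert (Hb : forall t, 0 <= t <= 1 -> INR n * lo <= Re (b t)).
  { intros t Ht. unfold b, d.
    replace (Re (INR n * a1 + t * (INR n * (a - a1)))) with (INR n * ((1 - t) * Re a1 + t * Re a))
      by (unfold Cminus, Cplus, Cmult, Copp, RtoC, Re; simpl; ring).
    apply Rmult_le_compat_l; nra. }
  set (kap := lo * PI ^ 2 / 2).
  assert (Hk : 0 < kap) by (unfold kap; apply Rdiv_lt_0_compat; [apply Rmult_lt_0_compat; nra | lra]).
  (* Order [n^(-2)] is enough: dividing later by a sum of size [1 / sqrt n] leaves [n^(-3/2)]. *)
  assert (Hexp : exp (- (INR n * kap)) <= 16 / (kap ^ 2 * INR n ^ 2)).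
  { pose proof (pow_exp_opp_le 2 (INR n * kap) ltac:(nra)) as H.
    assert (exp (- (INR n * kap / 2)) <= 1) by (rewrite <- exp_0; apply exp_monotone; nra).
    simpl INR in H. replace ((2 * (1 + 1)) ^ 2) with 16 in H by ring.
    assert (0 < kap ^ 2 * INR n ^ 2) by (apply Rmult_lt_0_compat; apply pow_lt; lra).
    apply Rle_div_r; [assumption|]. rewrite Rpow_mult_distr in H. lra. }
  assert (Dn : forall t, 0 <= t <= 1 -> Cmod (d * G t * (RtoC (2 * PI) * gauss (b t) PI))
      <= Cmod d * (4 * PI) * (2 * PI * (16 / (kap ^ 2 * INR n ^ 2)))).
  { intros t Ht. specialize (Hb t Ht).
    rewrite !Cmod_mult, Cmod_R, Rabs_pos_eq by lra.
    apply Rmult_le_compat.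
    - apply Rmult_le_pos; apply Cmod_ge_0.
    - apply Rmult_le_pos; [lra | apply Cmod_ge_0].
    - apply Rmult_le_compat_l; [apply Cmod_ge_0|]. apply Cmod_gauss_integral_le. nra.
    - apply Rmult_le_compat_l; [lra|].
      eapply Rle_trans; [|exact Hexp]. rewrite Cmod_gauss. apply exp_monotone.
      unfold kap. assert (0 <= PI ^ 2) by nra. nra. }
  assert (B : Cmod ((fun t => b t * (G t * G t))%C 1 - (fun t => b t * (G t * G t))%C 0)
     <= 2 * (Cmod d * (4 * PI) * (2 * PI * (16 / (kap ^ 2 * INR n ^ 2)))) * Rabs (1 - 0)).
  { apply (cmvt (fun t => b t * (G t * G t))%C (fun t => d * G t * (RtoC (2 * PI) * gauss (b t) PI))%C).
    rewrite Rmin_left, Rmax_right by lra. intros t Ht. split; [apply D | apply Dn, Ht]. }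
  cbv beta in B. rewrite Rminus_0_r, Rabs_R1, Rmult_1_r in B.
  assert (E1 : b 1 = (INR n * a)%C) by (unfold b, d; ring).
  assert (E0 : b 0 = (INR n * a1)%C) by (unfold b, d; ring).
  unfold G in B. rewrite E1, E0 in B.
  replace (INR n * a * (gauss_integral (INR n * a) * gauss_integral (INR n * a))
     - INR n * a1 * (gauss_integral (INR n * a1) * gauss_integral (INR n * a1)))%C with
   (INR n * (a * (gauss_integral (INR n * a) * gauss_integral (INR n * a))
        - a1 * (gauss_integral (INR n * a1) * gauss_integral (INR n * a1))))%C in B by ring.
  unfold d in B. rewrite Cmod_mult, (Cmod_mult (INR n)), Cmod_R, Rabs_pos_eq in B by lra.
  apply (Rmult_le_reg_l (INR n)); [lra|].
  eapply Rle_trans; [exact B|]. right. unfold kap. field. repeat split; lra.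
Qed.

(** * The phase at the saddle point *)

(** Equal to [(cis s)^m exp (w (cis s - 1))]. Differentiation maps these functions to combinations
    of neighbouring ones, so all derivatives of the phase are polynomials in [w] with such
    coefficients. *)
Definition phase_mode (m : nat) (w : C) (s : R) : C := Cexp (INR m * (Ci * s) + w * (cis s - 1)).

Lemma phase_mode_S m w s : phase_mode (S m) w s = (cis s * phase_mode m w s)%C.
Proof.
  unfold phase_mode. unfold cis at 2. rewrite <- Cexp_plus, S_INR, RtoC_plus. f_equal; ring.
Qed.

Lemma cderiv_phase_mode m w s :
  cderiv (phase_mode m w) s (Ci * (INR m * phase_mode m w s + w * phase_mode (S m) w s))%C.
Proof.
  eapply cderiv_eq; [apply cderiv_Cexp, cderiv_plus;
    [apply cderiv_scal, cderiv_scal, cderiv_id | apply cderiv_scal, cderiv_minus; [apply cderiv_cis | apply cderiv_const]]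
    | reflexivity |].
  cbv beta. fold (phase_mode m w s). rewrite phase_mode_S. ring.
Qed.

Lemma phase_mode_0 m w : phase_mode m w 0 = 1%C.
Proof. unfold phase_mode. rewrite cis_0, <- Cexp_0. f_equal. ring. Qed.

Lemma Cmod_cis_minus_1 s : Cmod (cis s - 1) <= 2.
Proof. eapply Rle_trans; [apply Cmod_triangle_minus|]. rewrite Cmod_cis, Cmod_1. lra. Qed.

Lemma Re_phase_mode_arg m w (s : R) r : Cmod w <= r -> Re (INR m * (Ci * s) + w * (cis s - 1)) <= 2 * r.
Proof.
  intros Hr.
  replace (Re (INR m * (Ci * s) + w * (cis s - 1))) with (Re (w * (cis s - 1)))
    by (unfold Cplus, Cmult, Ci, RtoC, Re; simpl; ring).
  eapply Rle_trans; [apply Re_le_Cmod|]. rewrite Cmod_mult.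
  pose proof (Cmod_cis_minus_1 s). pose proof (Cmod_ge_0 w). nra.
Qed.

Lemma Cmod_phase_mode_le m w s r : Cmod w <= r -> Cmod (phase_mode m w s) <= exp (2 * r).
Proof.
  intros Hr. unfold phase_mode. rewrite Cmod_Cexp. apply exp_monotone, Re_phase_mode_arg, Hr.
Qed.

Lemma phase_mode_lipschitz m w w' s r : Cmod w <= r -> Cmod w' <= r ->
  Cmod (phase_mode m w s - phase_mode m w' s) <= 4 * Cmod (w - w') * exp (2 * r).
Proof.
  intros Hr Hr'. unfold phase_mode.
  eapply Rle_trans; [apply (Cexp_lipschitz _ _ (2 * r)); apply Re_phase_mode_arg; assumption|].
  apply Rmult_le_compat_r; [left; apply exp_pos|].
  replace (INR m * (Ci * s) + w * (cis s - 1) - (INR m * (Ci * s) + w' * (cis s - 1)))%C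
    with ((w - w') * (cis s - 1))%C by ring.
  rewrite Cmod_mult. pose proof (Cmod_cis_minus_1 s). pose proof (Cmod_ge_0 (w - w')). nra.
Qed.

(** The first four derivatives of [phase w]. The division by [w] disappears after one
    differentiation; the coefficients 1, 3, 1 and 1, 7, 6, 1 are again Stirling numbers of the
    second kind. *)
Definition phase1 w s : C := (Ci * phase_mode 1 w s - Ci)%C.
Definition phase2 w s : C := (- (phase_mode 1 w s + w * phase_mode 2 w s))%C.
Definition phase3 w s : C := (- Ci * (phase_mode 1 w s + 3 * w * phase_mode 2 w s + w * w * phase_mode 3 w s))%C.
Definition phase4 w s : C :=
  (phase_mode 1 w s + 7 * w * phase_mode 2 w s + 6 * (w * w) * phase_mode 3 w s + w * w * w * phase_mode 4 w s)%C.

Lemma Ci_sqr : (Ci * Ci)%C = (- (1))%C.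
Proof. apply C_ext; unfold Ci, Re, Im; simpl; ring. Qed.

Lemma phase_at_0 w : phase w 0 = 0%C.
Proof.
  unfold phase. rewrite cis_0. replace (w * (1 - 1))%C with (RtoC 0) by ring. rewrite Cexp_0.
  unfold Cdiv. ring.
Qed.

Lemma cderiv_phase (w : C) (s : R) : w <> 0%C -> cderiv (phase w) s (phase1 w s).
Proof.
  intros Hw. eapply cderiv_eq; [apply cderiv_minus;
    [apply (cderiv_scal (/ w)), cderiv_minus; [apply (cderiv_phase_mode 0 w) | apply (cderiv_const 1)]
    | apply (cderiv_scal Ci), cderiv_id] | |].
  - intros t. unfold phase, phase_mode. cbv beta. simpl INR.
    replace (0 * (Ci * t) + w * (cis t - 1))%C with (w * (cis t - 1))%C by ring. unfold Cdiv; ring.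
  - unfold phase1. simpl INR. field. assumption.
Qed.

Lemma cderiv_phase1 w s : cderiv (phase1 w) s (phase2 w s).
Proof.
  eapply cderiv_eq; [apply cderiv_minus; [apply (cderiv_scal Ci), cderiv_phase_mode | apply (cderiv_const Ci)] | reflexivity |].
  unfold phase2. simpl INR.
  transitivity (Ci * Ci * (phase_mode 1 w s + w * phase_mode 2 w s))%C; [ring | rewrite Ci_sqr; ring].
Qed.

Lemma cderiv_phase2 w s : cderiv (phase2 w) s (phase3 w s).
Proof.
  eapply cderiv_eq; [apply (cderiv_scal (-1)), cderiv_plus; [apply (cderiv_phase_mode 1 w) | apply (cderiv_scal w), (cderiv_phase_mode 2 w)] | |].
  - intros t; unfold phase2; cbv beta; ring.
  - unfold phase3. replace (RtoC (INR 2)) with (RtoC 2) by (f_equal; simpl; ring). simpl INR. ring.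
Qed.

Lemma cderiv_phase3 w s : cderiv (phase3 w) s (phase4 w s).
Proof.
  eapply cderiv_eq; [apply (cderiv_scal (- Ci)%C), cderiv_plus; [apply cderiv_plus; [apply cderiv_phase_mode|]|];
    [apply (cderiv_scal (3 * w)%C), cderiv_phase_mode | apply (cderiv_scal (w * w)%C), cderiv_phase_mode] | reflexivity |].
  unfold phase4. replace (RtoC (INR 2)) with (RtoC 2) by (f_equal; simpl; ring).
  replace (RtoC (INR 3)) with (RtoC 3) by (f_equal; simpl; ring). simpl INR.
  generalize (phase_mode 1 w s) (phase_mode 2 w s) (phase_mode 3 w s) (phase_mode 4 w s); intros p1 p2 p3 p4.
  transitivity (- (Ci * Ci) * (p1 + 7 * w * p2 + 6 * (w * w) * p3 + w * w * w * p4))%C; [ring|].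
  rewrite Ci_sqr; ring.
Qed.

Lemma cderiv_monomial (j : nat) (t : R) : cderiv (fun s => RtoC (s ^ j)) t (RtoC (INR j * t ^ pred j)).
Proof. apply cderiv_RtoC. auto_derive; [exact I | ring]. Qed.

(** Majorant of the fourth derivative for [|w| <= r]; the exponential comes from
    [|cis s - 1| <= 2]. *)
Definition phase_bound (r : R) : R := (1 + 7 * r + 6 * r ^ 2 + r ^ 3) * exp (2 * r).

Lemma phase_bound_ge_0 r : 0 <= r -> 0 <= phase_bound r.
Proof.
  intros Hr. unfold phase_bound. apply Rmult_le_pos; [|left; apply exp_pos].
  assert (0 <= r ^ 2) by nra. assert (0 <= r ^ 3) by (apply pow_le; assumption). lra.
Qed.

Lemma Cmod_phase4_le w s r : Cmod w <= r -> Cmod (phase4 w s) <= phase_bound r.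
Proof.
  intros Hr. pose proof (Cmod_ge_0 w) as H0. pose proof (exp_pos (2 * r)) as He.
  assert (P : forall m, Cmod (phase_mode m w s) <= exp (2 * r)) by (intros; apply Cmod_phase_mode_le, Hr).
  assert (Q : forall k m c, Cmod k <= c -> Cmod (k * phase_mode m w s) <= c * exp (2 * r)).
  { intros k m c Hk. rewrite Cmod_mult. apply Rmult_le_compat; auto using Cmod_ge_0. }
  assert (W2 : Cmod (w * w) <= r ^ 2) by (rewrite Cmod_mult; nra).
  assert (W3 : Cmod (w * w * w) <= r ^ 3).
  { rewrite Cmod_mult. replace (r ^ 3) with (r ^ 2 * r) by ring. apply Rmult_le_compat; auto using Cmod_ge_0. }
  unfold phase4, phase_bound.
  eapply Rle_trans; [apply Cmod_triangle|]. rewrite !Rmult_plus_distr_r.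
  apply Rplus_le_compat; [|apply Q, W3].
  eapply Rle_trans; [apply Cmod_triangle|].
  apply Rplus_le_compat; [|apply Q; rewrite Cmod_mult, Cmod_R, Rabs_pos_eq by lra; lra].
  eapply Rle_trans; [apply Cmod_triangle|].
  apply Rplus_le_compat; [|apply Q; rewrite Cmod_mult, Cmod_R, Rabs_pos_eq by lra; lra].
  rewrite Rmult_1_l; apply P.
Qed.

(** The bound on the fourth derivative is integrated four times by [cmvt_pow], whence 16. That
    [phase1 w 0 = 0] is the saddle point condition. *)
Lemma phase_taylor (w : C) (r s : R) : w <> 0%C -> Cmod w <= r ->
  Cmod (phase w s + (1 + w) * RtoC (s ^ 2 / 2) - phase3 w 0 * RtoC (s ^ 3 / 6))
    <= 16 * phase_bound r * Rabs s ^ 4.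
Proof.
  intros Hw Hr. set (K := phase_bound r).
  assert (HK : 0 <= K) by (apply phase_bound_ge_0; pose proof (Cmod_ge_0 w); lra).
  assert (E20 : phase2 w 0 = (- (1 + w))%C) by (unfold phase2; rewrite !phase_mode_0; ring).
  assert (E10 : phase1 w 0 = 0%C) by (unfold phase1; rewrite !phase_mode_0; ring).
  set (c := phase3 w 0).
  assert (B3 : forall t, Cmod (phase3 w t - c) <= 2 * K * Rabs t ^ 1).
  { intros t. apply (cmvt_pow (fun t => phase3 w t - c)%C (phase4 w) K t 0 HK).
    - unfold c; ring.
    - intros u _. split.
      + eapply cderiv_eq; [apply cderiv_minus; [apply cderiv_phase3 | apply (cderiv_const c)] | reflexivity | ring].
      + simpl pow. rewrite Rmult_1_r. apply Cmod_phase4_le, Hr. }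
  assert (B2 : forall t, Cmod (phase2 w t + (1 + w) - c * RtoC (t ^ 1)) <= 2 * (2 * K) * Rabs t ^ 2).
  { intros t. apply (cmvt_pow (fun t => phase2 w t + (1 + w) - c * RtoC (t ^ 1))%C (fun t => phase3 w t - c)%C (2 * K) t 1); [lra| |].
    - rewrite E20, RtoC_pow. simpl. ring.
    - intros u _. split; [|apply B3].
      eapply cderiv_eq; [apply cderiv_minus; [apply cderiv_plus; [apply cderiv_phase2 | apply (cderiv_const (1 + w)%C)] |
         apply (cderiv_scal c), (cderiv_monomial 1)] | reflexivity |].
      simpl. rewrite Rmult_1_r. ring. }
  assert (B1 : forall t, Cmod (phase1 w t + (1 + w) * RtoC (t ^ 1) - c * / 2 * RtoC (t ^ 2)) <= 2 * (2 * (2 * K)) * Rabs t ^ 3).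
  { intros t. apply (cmvt_pow (fun t => phase1 w t + (1 + w) * RtoC (t ^ 1) - c * / 2 * RtoC (t ^ 2))%C
      (fun t => phase2 w t + (1 + w) - c * RtoC (t ^ 1))%C (2 * (2 * K)) t 2); [lra| |].
    - rewrite E10, !RtoC_pow. simpl. ring.
    - intros u _. split; [|apply B2].
      eapply cderiv_eq; [apply cderiv_minus; [apply cderiv_plus; [apply cderiv_phase1 | apply (cderiv_scal (1 + w)%C), (cderiv_monomial 1)] |
         apply (cderiv_scal (c * / 2)%C), (cderiv_monomial 2)] | reflexivity |].
      simpl. rewrite !RtoC_mult, RtoC_plus. field. }
  pose proof (cmvt_pow (fun t => phase w t + (1 + w) * / 2 * RtoC (t ^ 2) - c * / 6 * RtoC (t ^ 3))%C
      (fun t => phase1 w t + (1 + w) * RtoC (t ^ 1) - c * / 2 * RtoC (t ^ 2))%C (2 * (2 * (2 * K))) s 3 ltac:(lra)) as B0.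
  cbv beta in B0.
  replace (phase w s + (1 + w) * RtoC (s ^ 2 / 2) - c * RtoC (s ^ 3 / 6))%C with
    (phase w s + (1 + w) * / 2 * RtoC (s ^ 2) - c * / 6 * RtoC (s ^ 3))%C
    by (unfold Rdiv; rewrite !RtoC_mult, !RtoC_inv by lra; ring).
  replace (16 * K) with (2 * (2 * (2 * (2 * K)))) by ring.
  apply B0.
  - rewrite phase_at_0, !RtoC_pow. simpl. ring.
  - intros u _. split; [|apply B1].
    eapply cderiv_eq; [apply cderiv_minus; [apply cderiv_plus; [apply cderiv_phase, Hw | apply (cderiv_scal ((1 + w) * / 2)%C), (cderiv_monomial 2)] |
       apply (cderiv_scal (c * / 6)%C), (cderiv_monomial 3)] | reflexivity |].
    cbn [pred pow INR]. rewrite !RtoC_mult, !RtoC_plus. field.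
Qed.

Lemma Cmod_phase3_0_le w r : Cmod w <= r -> Cmod (phase3 w 0) <= 1 + 3 * r + r ^ 2.
Proof.
  intros Hr. pose proof (Cmod_ge_0 w). unfold phase3. rewrite !phase_mode_0, Cmod_mult, Cmod_opp, Cmod_Ci, Rmult_1_l, !Cmult_1_r.
  eapply Rle_trans; [apply Cmod_triangle|]. apply Rplus_le_compat; [|rewrite Cmod_mult; nra].
  eapply Rle_trans; [apply Cmod_triangle|]. rewrite Cmod_1, Cmod_mult, Cmod_R, Rabs_pos_eq by lra. lra.
Qed.

(** Every phase vanishes at 0 together with its first derivative, so the difference carries a factor
    [s^2]; this allows it to be absorbed by quadratic decay even near [s = 0]. *)
Lemma phase_lipschitz (w w' : C) (r s : R) : w <> 0%C -> w' <> 0%C -> Cmod w <= r -> Cmod w' <= r ->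
  Cmod (phase w s - phase w' s) <= 4 * ((5 + 4 * r) * exp (2 * r)) * Cmod (w - w') * s ^ 2.
Proof.
  intros Hw Hw' Hr Hr'. pose proof (exp_pos (2 * r)) as He. pose proof (Cmod_ge_0 w) as H0.
  pose proof (Cmod_ge_0 (w - w')) as Hd.
  set (K := (5 + 4 * r) * exp (2 * r) * Cmod (w - w')).
  assert (HK : 0 <= K) by (unfold K; apply Rmult_le_pos; nra).
  assert (B1 : forall t, Cmod (phase1 w t - phase1 w' t) <= 2 * K * Rabs t ^ 1).
  { intros t. apply (cmvt_pow (fun t => phase1 w t - phase1 w' t)%C (fun t => phase2 w t - phase2 w' t)%C K t 0 HK).
    - unfold phase1. rewrite !phase_mode_0. ring.
    - intros u _. split; [apply cderiv_minus; apply cderiv_phase1|].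
      simpl pow. rewrite Rmult_1_r. unfold phase2, K.
      replace (- (phase_mode 1 w u + w * phase_mode 2 w u) - - (phase_mode 1 w' u + w' * phase_mode 2 w' u))%C
        with (- ((phase_mode 1 w u - phase_mode 1 w' u) + (w' * (phase_mode 2 w u - phase_mode 2 w' u)
          + (w - w') * phase_mode 2 w u)))%C by ring.
      rewrite Cmod_opp.
      pose proof (phase_mode_lipschitz 1 w w' u r Hr Hr') as L1.
      pose proof (phase_mode_lipschitz 2 w w' u r Hr Hr') as L2.
      pose proof (Cmod_phase_mode_le 2 w u r Hr) as L3.
      eapply Rle_trans; [apply Cmod_triangle|].
      apply Rle_trans with (4 * Cmod (w - w') * exp (2 * r) + (r * (4 * Cmod (w - w') * exp (2 * r)) + Cmod (w - w') * exp (2 * r))); [|right; ring].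
      apply Rplus_le_compat; [exact L1|].
      eapply Rle_trans; [apply Cmod_triangle|]. rewrite !Cmod_mult.
      apply Rplus_le_compat; apply Rmult_le_compat; auto using Cmod_ge_0; lra. }
  replace (4 * ((5 + 4 * r) * exp (2 * r)) * Cmod (w - w') * s ^ 2) with (2 * (2 * K) * Rabs s ^ 2)
    by (rewrite pow2_abs; unfold K; ring).
  apply (cmvt_pow (fun t => phase w t - phase w' t)%C (fun t => phase1 w t - phase1 w' t)%C (2 * K) s 1); [lra| |].
  - rewrite !phase_at_0; ring.
  - intros u _; split; [apply cderiv_minus; apply cderiv_phase; assumption | apply B1].
Qed.

(** From [1 - cos t = 2 sin (t / 2)^2] and the cubic lower bound of the sine, which is at least
    [t / 6] for [0 <= t <= 4]. *)
Lemma one_minus_cos_ge (s : R) : - PI <= s <= PI -> s ^ 2 / 18 <= 1 - cos s.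
Proof.
  assert (P : forall s, 0 <= s <= PI -> s ^ 2 / 18 <= 1 - cos s).
  { intros t Ht. pose proof PI_4 as H4.
    replace (cos t) with (cos (2 * (t / 2))) by (f_equal; field).
    rewrite cos_2a_sin.
    assert (HS := proj1 (sin_bound (t / 2) 0 ltac:(lra) ltac:(lra))).
    unfold sin_approx, sin_term in HS. simpl in HS.
    assert (H6 : t / 6 <= sin (t / 2)).
    { apply Rle_trans with (t / 2 - (t / 2) ^ 3 / 6); [|eapply Rle_trans; [|exact HS]; right; field].
      replace (t / 2 - (t / 2) ^ 3 / 6) with (t / 6 + t * (16 - t * t) / 48) by field.
      assert (0 <= t * (16 - t * t)) by (apply Rmult_le_pos; nra). lra. }
    nra. }
  intros Hs. destruct (Rle_dec 0 s) as [H|H].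
  - apply P; lra.
  - rewrite <- cos_neg. replace (s ^ 2) with ((- s) ^ 2) by ring. apply P; lra.
Qed.

(** With [y = 1 - cos s], the exponential in the phase has modulus [exp (- w y)], and [1 - exp (- w
    y) >= w y exp (- w y) >= w y exp (- 2 w)] since [y <= 2]. *)
Lemma Re_phase_real_le (w s : R) : 0 < w -> - PI <= s <= PI ->
  Re (phase w s) <= - (exp (- (2 * w)) / 18 * s ^ 2).
Proof.
  intros Hw Hs.
  set (y := 1 - cos s).
  assert (Hy : s ^ 2 / 18 <= y) by (apply one_minus_cos_ge, Hs).
  assert (Hy0 : 0 <= y <= 2) by (unfold y; pose proof (COS_bound s); lra).
  assert (E : Re (phase w s) = (Re (Cexp (w * (cis s - 1))) - 1) / w).
  { unfold phase. unfold Cdiv. rewrite <- RtoC_inv by lra.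
    replace ((Cexp (w * (cis s - 1)) - 1) * RtoC (/ w) - Ci * s)%C with ((Cexp (w * (cis s - 1)) + (-1)) * RtoC (/ w) + (- Ci) * s)%C by ring.
    unfold Rdiv. set (e := Cexp _). unfold Cplus, Cmult, Copp, Ci, RtoC, Re; simpl. ring. }
  rewrite E.
  assert (H1 : Re (Cexp (w * (cis s - 1))) <= exp (- (w * y))).
  { eapply Rle_trans; [apply Re_le_Cmod|]. rewrite Cmod_Cexp. apply exp_monotone.
    rewrite cis_eq. unfold y, Cminus, Cplus, Cmult, Copp, RtoC, Re; simpl. lra. }
  assert (H2 : exp (- (w * y)) - 1 <= - (w * y * exp (- (2 * w)))).
  { assert (A : 1 + w * y <= exp (w * y)) by apply exp_ineq1_le.
    assert (B : exp (- (w * y)) * exp (w * y) = 1) by (rewrite <- exp_plus, <- exp_0; f_equal; ring).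
    assert (D : exp (- (2 * w)) <= exp (- (w * y))) by (apply exp_monotone; nra).
    pose proof (exp_pos (- (w * y))).
    assert (w * y * exp (- (2 * w)) <= w * y * exp (- (w * y))) by (apply Rmult_le_compat_l; nra). nra. }
  apply (Rmult_le_reg_r w); [assumption|].
  replace ((Re (Cexp (w * (cis s - 1))) - 1) / w * w) with (Re (Cexp (w * (cis s - 1))) - 1) by (field; lra).
  assert (s ^ 2 / 18 * (w * exp (- (2 * w))) <= y * (w * exp (- (2 * w)))).
  { apply Rmult_le_compat_r; [|assumption]. pose proof (exp_pos (- (2 * w))). nra. }
  lra.
Qed.

(** Half of the decay at [w0] is given up for the perturbation, hence 36 instead of 18. The bound
    [c <= 1/2] lets the same [c] dominate the Gaussian with parameter [1 + w]. *)
Lemma Re_phase_le (w0 : R) : 0 < w0 -> exists delta c : R, 0 < delta /\ delta <= w0 / 2 /\ delta <= 1 /\ 0 < c <= / 2 /\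
  forall (w : C) (s : R), Cmod (w - w0) <= delta -> - PI <= s <= PI -> Re (phase w s) <= - (c * s ^ 2).
Proof.
  intros Hw0. set (r := w0 + 1).
  set (K := 4 * ((5 + 4 * r) * exp (2 * r))).
  assert (HK : 0 < K) by (unfold K, r; pose proof (exp_pos (2 * (w0 + 1))); nra).
  set (c := exp (- (2 * w0)) / 36).
  assert (Hc : 0 < c <= / 2).
  { unfold c. pose proof (exp_pos (- (2 * w0))). split; [lra|].
    assert (exp (- (2 * w0)) <= 1) by (rewrite <- exp_0; apply exp_monotone; lra). lra. }
  exists (Rmin (Rmin (w0 / 2) 1) (c / K)), c.
  pose proof (Rmin_l (Rmin (w0 / 2) 1) (c / K)). pose proof (Rmin_r (Rmin (w0 / 2) 1) (c / K)).
  pose proof (Rmin_l (w0 / 2) 1). pose proof (Rmin_r (w0 / 2) 1).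
  assert (0 < c / K) by (apply Rdiv_lt_0_compat; lra).
  repeat split; try lra; [repeat apply Rmin_pos; lra|].
  intros w s Hw Hs.
  assert (N0 : RtoC w0 <> 0%C) by (intros E; apply RtoC_inj in E; lra).
  assert (N : w <> 0%C).
  { intros ->. rewrite <- Cmod_opp in Hw. replace (- (0 - w0))%C with (RtoC w0) in Hw by ring.
    rewrite Cmod_R, Rabs_pos_eq in Hw by lra. lra. }
  assert (R0 : Cmod w0 <= r) by (rewrite Cmod_R, Rabs_pos_eq by lra; unfold r; lra).
  assert (Rw : Cmod w <= r).
  { replace w with (w0 + (w - w0))%C by ring. eapply Rle_trans; [apply Cmod_triangle|].
    rewrite Cmod_R, Rabs_pos_eq by lra. unfold r; lra. }
  pose proof (phase_lipschitz w w0 r s N N0 Rw R0) as L. fold K in L.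
  pose proof (Re_phase_real_le w0 s Hw0 Hs) as P.
  pose proof (Re_le_Cmod (phase w s - phase w0 s)) as Q.
  replace (Re (phase w s - phase w0 s)) with (Re (phase w s) - Re (phase w0 s)) in Q by reflexivity.
  assert (K * Cmod (w - w0) * s ^ 2 <= c * s ^ 2).
  { apply Rmult_le_compat_r; [nra|]. apply (Rmult_le_reg_l (/ K)); [apply Rinv_0_lt_compat; assumption|].
    rewrite <- Rmult_assoc, Rinv_l, Rmult_1_l by lra. unfold Rdiv in *. lra. }
  unfold c in *. lra.
Qed.

(** * Asymptotics of the saddle point integral *)

Lemma RInt_lin_comb (f g : R -> R) (alpha beta a b : R) :
  (forall t, continuous f t) -> (forall t, continuous g t) ->
  (forall t, continuous (fun s => alpha * f s + beta * g s) t) /\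
  RInt (fun s => alpha * f s + beta * g s) a b = alpha * RInt f a b + beta * RInt g a b.
Proof.
  intros Hf Hg.
  assert (Cf : forall k h, (forall t, continuous h t) -> forall t : R, continuous (fun s => k * h s) t)
    by (intros k h Hh t; apply (continuous_scal_r (V := R_NormedModule) k h), Hh).
  split.
  - intros t. apply (continuous_plus (V := R_NormedModule)); apply Cf; assumption.
  - rewrite (RInt_plus (V := R_CompleteNormedModule) (fun s => alpha * f s) (fun s => beta * g s))
      by (apply ex_RInt_cont, Cf; assumption).
    apply (f_equal2 Rplus).
    + apply (RInt_scal (V := R_CompleteNormedModule) f), ex_RInt_cont, Hf.
    + apply (RInt_scal (V := R_CompleteNormedModule) g), ex_RInt_cont, Hg.
Qed.

Lemma near_real_Re (w : C) (w0 delta : R) : Cmod (w - w0) <= delta -> w0 - delta <= Re w.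
Proof.
  intros H. pose proof (Re_ge_opp_Cmod (w - w0)) as P.
  replace (Re (w - w0)) with (Re w - w0) in P by reflexivity. lra.
Qed.

Lemma near_real_Cmod (w : C) (w0 delta : R) : 0 <= w0 -> Cmod (w - w0) <= delta -> Cmod w <= w0 + delta.
Proof.
  intros H0 H. replace w with (w0 + (w - w0))%C by ring.
  eapply Rle_trans; [apply Cmod_triangle|]. rewrite Cmod_R, Rabs_pos_eq by assumption. lra.
Qed.

Lemma Re_pos_neq_0 (w : C) : 0 < Re w -> w <> 0%C.
Proof. intros H ->. simpl in H. lra. Qed.

(** The true and the Gaussian exponent both have real part at most [- q s^2] with [q = n c]. The
    errors [n^2 s^6] and [n s^4] against [exp (- q s^2)] integrate to order [n^2 q^(-7/2)] and
    [n q^(-5/2)], both [n^(-3/2)]. *)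
Lemma saddle_integral_gauss (w0 : R) : 0 < w0 -> exists delta M : R, 0 < delta /\ delta <= w0 / 2 /\ 0 <= M /\
  forall (n : nat) (w : C), (1 <= n)%nat -> Cmod (w - w0) <= delta ->
    Cmod (saddle_integral n w - gauss_integral (INR n * (1 + w))) <= M / (INR n * sqrt (INR n)).
Proof.
  intros Hw0. destruct (Re_phase_le w0 Hw0) as (delta & c & Hd & Hd2 & Hd1 & Hc & Hphase).
  (* In [A3] the quartic remainder is absorbed into the cubic bound by [|s| <= 4]. *)
  set (r := w0 + 1). set (A4 := 16 * phase_bound r). set (A3 := 4 * A4 + (1 + 3 * r + r ^ 2)).
  assert (HA4 : 0 <= A4) by (unfold A4; pose proof (phase_bound_ge_0 r ltac:(unfold r; lra)); lra).
  assert (Hsc : 0 < sqrt c) by (apply sqrt_lt_R0; lra).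
  exists delta, (2 * (4 * A3 ^ 2 * (8 * 6 ^ 3) / (c ^ 3 * sqrt c) + A4 * (8 * 4 ^ 2) / (c ^ 2 * sqrt c))).
  split; [assumption | split; [assumption | split]].
  { assert (0 < c ^ 3) by (apply pow_lt; lra). assert (0 < c ^ 2) by (apply pow_lt; lra).
    apply Rmult_le_pos; [lra|]. apply Rplus_le_le_0_compat; apply Rdiv_le_0_compat; try (apply Rmult_lt_0_compat; assumption).
    - pose proof (pow2_ge_0 A3). lra.
    - lra. }
  intros n w Hn Hw. assert (Hn1 := INR_ge_1 n Hn).
  assert (pc : - PI <= PI) by (pose proof PI_RGT_0; lra).
  assert (HRe : w0 / 2 <= Re w) by (pose proof (near_real_Re w w0 delta Hw); lra).
  assert (Hw0' : w <> 0%C) by (apply Re_pos_neq_0; lra).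
  assert (Hr : Cmod w <= r) by (pose proof (near_real_Cmod w w0 delta ltac:(lra) Hw); unfold r; lra).
  set (b := (INR n * (1 + w))%C).
  assert (Hb : b <> 0%C).
  { apply Re_pos_neq_0. unfold b. rewrite re_scal_l. replace (Re (1 + w)) with (1 + Re w) by reflexivity. nra. }
  set (q := INR n * c). assert (Hq : 0 < q) by (unfold q; nra).
  set (c3 := (INR n * phase3 w 0 / 6)%C).
  assert (cJ : ccont (fun s => Cexp (INR n * phase w s))).
  { eapply cderiv_ccont. intros t. apply cderiv_Cexp, cderiv_scal, cderiv_phase, Hw0'. }
  assert (cG3 : ccont (fun s => gauss b s * RtoC (s ^ 3))%C) by (apply ccont_mult; [apply ccont_gauss | apply ccont_pow]).
  (* The cubic term, of integral 0, is subtracted before absolute values are taken. *)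
  assert (E : (saddle_integral n w - gauss_integral b)%C
    = CInt (fun s => Cexp (INR n * phase w s) - gauss b s - c3 * (gauss b s * RtoC (s ^ 3)))%C (- PI) PI).
  { rewrite (CInt_minus (fun s => Cexp (INR n * phase w s) - gauss b s)%C);
      [|apply ccont_minus; [exact cJ | apply ccont_gauss] | apply ccont_scal, cG3].
    rewrite CInt_minus; [|exact cJ | apply ccont_gauss].
    rewrite CInt_scal by exact cG3. rewrite gauss_cubic_moment by exact Hb.
    unfold saddle_integral, gauss_integral. ring. }
  rewrite E.
  set (f6 := fun s => s ^ (2 * 3) * exp (- (q * s ^ 2))). set (f4 := fun s => s ^ (2 * 2) * exp (- (q * s ^ 2))).
  destruct (RInt_lin_comb f6 f4 (4 * INR n ^ 2 * A3 ^ 2) (INR n * A4) (- PI) PI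
    (continuous_monomial_exp _ q) (continuous_monomial_exp _ q)) as [Cg Eg].
  eapply Rle_trans; [apply (Cmod_CInt_le _ (fun s => 4 * INR n ^ 2 * A3 ^ 2 * f6 s + INR n * A4 * f4 s) _ _ pc); [|exact Cg|]|].
  - apply ccont_minus; [apply ccont_minus; [exact cJ | apply ccont_gauss] | apply ccont_scal, cG3].
  - intros s Hs.
    set (X := (INR n * phase w s)%C). set (Y := (- (b * RtoC (s ^ 2 / 2)))%C).
    assert (Hs4 : Rabs s <= 4) by (pose proof PI_4; apply Rabs_le; lra).
    pose proof (phase_taylor w r s Hw0' Hr) as T4. fold A4 in T4.
    assert (T3 : Cmod (phase w s + (1 + w) * RtoC (s ^ 2 / 2)) <= A3 * Rabs s ^ 3).
    { replace (phase w s + (1 + w) * RtoC (s ^ 2 / 2))%C with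
        ((phase w s + (1 + w) * RtoC (s ^ 2 / 2) - phase3 w 0 * RtoC (s ^ 3 / 6)) + phase3 w 0 * RtoC (s ^ 3 / 6))%C by ring.
      eapply Rle_trans; [apply Cmod_triangle|]. unfold A3. rewrite Rmult_plus_distr_r.
      pose proof (Rabs_pos s) as Ha. assert (Ha3 : 0 <= Rabs s ^ 3) by (apply pow_le; assumption).
      apply Rplus_le_compat.
      - eapply Rle_trans; [exact T4|].
        replace (A4 * Rabs s ^ 4) with (Rabs s * (A4 * Rabs s ^ 3)) by ring.
        rewrite Rmult_assoc. apply Rmult_le_compat_r; [apply Rmult_le_pos|]; assumption.
      - rewrite Cmod_mult, Cmod_R. apply Rmult_le_compat; auto using Cmod_ge_0, Rabs_pos.
        + apply Cmod_phase3_0_le, Hr.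
        + unfold Rdiv. rewrite Rabs_mult, <- RPow_abs, (Rabs_pos_eq (/ 6)) by lra. lra. }
    assert (HX : Re X <= - (q * s ^ 2)).
    { unfold X. rewrite re_scal_l. specialize (Hphase w s Hw ltac:(lra)). unfold q. nra. }
    assert (HY : Re Y <= - (q * s ^ 2)).
    { replace (Re Y) with (- (INR n * ((1 + Re w) / 2 * s ^ 2)))
        by (unfold Y, b, Cmult, Cplus, Copp, RtoC, Re; simpl; field).
      unfold q. rewrite Rmult_assoc. apply Ropp_le_contravar, Rmult_le_compat_l; [lra|].
      apply Rmult_le_compat_r; [nra | lra]. }
    assert (EXY : (X - Y)%C = (INR n * (phase w s + (1 + w) * RtoC (s ^ 2 / 2)))%C) by (unfold X, Y, b; ring).
    (* A second-order remainder of the exponential, plus the quartic remainder of the phase times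
       the Gaussian. *)
    replace (Cexp X - gauss b s - c3 * (gauss b s * RtoC (s ^ 3)))%C with
      ((Cexp X - Cexp Y * (1 + (X - Y))) + INR n * (phase w s + (1 + w) * RtoC (s ^ 2 / 2) - phase3 w 0 * RtoC (s ^ 3 / 6)) * Cexp Y)%C.
    2:{ rewrite EXY. change (gauss b s) with (Cexp Y). unfold c3, Rdiv. rewrite !RtoC_mult, (RtoC_inv 6) by lra. field. }
    eapply Rle_trans; [apply Cmod_triangle|]. apply Rplus_le_compat.
    + eapply Rle_trans; [apply (Cexp_taylor2 _ _ _ HX HY)|].
      unfold f6. rewrite <- Rmult_assoc. apply Rmult_le_compat_r; [left; apply exp_pos|].
      rewrite EXY, Cmod_mult, Cmod_R, Rabs_pos_eq, Rpow_mult_distr, !Rmult_assoc by lra.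
      apply Rmult_le_compat_l; [lra|]. apply Rmult_le_compat_l; [apply pow2_ge_0|].
      replace (s ^ (2 * 3)) with ((Rabs s ^ 3) ^ 2).
      * rewrite <- Rpow_mult_distr. apply pow_incr. split; [apply Cmod_ge_0 | exact T3].
      * rewrite <- pow_mult, Nat.mul_comm, !pow_mult, pow2_abs. reflexivity.
    + unfold f4. rewrite !Cmod_mult, Cmod_R, Rabs_pos_eq, Cmod_Cexp, !Rmult_assoc by lra.
      apply Rmult_le_compat_l; [lra|]. rewrite <- Rmult_assoc.
      apply Rmult_le_compat; [apply Cmod_ge_0 | left; apply exp_pos | | apply exp_monotone, HY].
      replace (s ^ (2 * 2)) with (Rabs s ^ 4); [exact T4|].
      replace 4%nat with (2 * 2)%nat by reflexivity. rewrite !pow_mult, pow2_abs. reflexivity.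
  - rewrite Eg.
    pose proof (gauss_moment_le 3 q Hq) as B6. pose proof (gauss_moment_le 2 q Hq) as B4.
    replace (2 * INR 3) with 6 in B6 by (simpl; ring). replace (2 * INR 2) with 4 in B4 by (simpl; ring).
    fold f6 in B6. fold f4 in B4.
    assert (K6 : 0 <= 4 * INR n ^ 2 * A3 ^ 2) by (pose proof (pow2_ge_0 (INR n)); pose proof (pow2_ge_0 A3); nra).
    assert (K4 : 0 <= INR n * A4) by nra.
    apply (Rmult_le_compat_l _ _ _ K6) in B6. apply (Rmult_le_compat_l _ _ _ K4) in B4.
    assert (Hs : sqrt q = sqrt (INR n) * sqrt c) by (apply sqrt_mult; lra).
    assert (Hsn : 0 < sqrt (INR n)) by (apply sqrt_lt_R0; lra).
    eapply Rle_trans; [apply Rmult_le_compat_l; [lra|]; apply Rplus_le_compat; [exact B6 | exact B4]|].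
    right. rewrite Hs. unfold q. field. repeat split; lra.
Qed.

(** With [G] and [g] the two integrals, [(G - sigma g) (G + sigma g) = (a G^2 - a1 g^2) / a] is
    [O(n^(-2))]. As [g] is real and nonnegative and [Re sigma >= 0], the second factor has real part
    at least [Re G], of order [1 / sqrt n], and can be divided out. *)
Lemma gauss_integral_ratio (a0 a1 : R) : 0 < a0 -> 0 < a1 -> exists delta M : R, 0 < delta /\ 0 <= M /\
  forall (n : nat) (a sigma : C), (1 <= n)%nat -> Cmod (a - a0) <= delta ->
    (sigma * sigma)%C = (a1 / a)%C -> 0 <= Re sigma ->
    Cmod (gauss_integral (INR n * a) - sigma * gauss_integral (INR n * a1)) <= M / (INR n * sqrt (INR n)).
Proof.
  intros Ha0 Ha1.
  destruct (gauss_integral_Re_ge a0 Ha0) as (d0 & c & Hd0 & Hc & HG).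
  set (lo := Rmin (a0 / 2) a1). assert (Hlo : 0 < lo) by (apply Rmin_pos; lra).
  set (delta := Rmin d0 (a0 / 2)).
  assert (Hdl := Rmin_l d0 (a0 / 2)). assert (Hdr := Rmin_r d0 (a0 / 2)). fold delta in Hdl, Hdr.
  set (K := 1024 / (lo ^ 2 * PI ^ 2) * (a0 + delta + a1)).
  assert (Hd : 0 < delta) by (apply Rmin_pos; lra).
  assert (HPL : 0 < lo ^ 2 * PI ^ 2) by (apply Rmult_lt_0_compat; apply pow_lt; [assumption | apply PI_RGT_0]).
  assert (HK : 0 <= K) by (unfold K; apply Rmult_le_pos; [apply Rdiv_le_0_compat; lra | lra]).
  exists delta, (K / (lo * c)). split; [assumption | split; [apply Rdiv_le_0_compat; nra|]].
  intros n a sigma Hn Ha Hsig HRs. assert (Hn1 := INR_ge_1 n Hn).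
  assert (HRa : lo <= Re a).
  { pose proof (near_real_Re a a0 delta Ha). pose proof (Rmin_l (a0 / 2) a1). fold lo in H0. lra. }
  assert (Ha0' : a <> 0%C) by (apply Re_pos_neq_0; lra).
  pose proof (gauss_integral_square a a1 lo n Hn Hlo HRa (Rmin_r _ _)) as B.
  set (G := gauss_integral (INR n * a)) in *.
  assert (Hg1 : 0 <= Re (gauss_integral (INR n * a1)) /\ Im (gauss_integral (INR n * a1)) = 0).
  { pose proof (gauss_integral_real_ge a1 n Hn Ha1) as L.
    assert (0 < sqrt (INR n)) by (apply sqrt_lt_R0; lra). split.
    - eapply Rle_trans; [|exact L]. apply Rdiv_le_0_compat; [pose proof (exp_pos (- (a1 / 2))); lra | assumption].
    - rewrite <- RtoC_mult, gauss_integral_real. reflexivity. }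
  set (g := gauss_integral (INR n * a1)) in *.
  assert (Hrn : 0 < sqrt (INR n)) by (apply sqrt_lt_R0; lra).
  assert (Hsum : c / sqrt (INR n) <= Cmod (G + sigma * g)).
  { eapply Rle_trans; [|apply Re_le_Cmod].
    replace (Re (G + sigma * g)) with (Re G + (Re sigma * Re g - Im sigma * Im g)) by reflexivity.
    destruct Hg1 as [Hg1 ->]. specialize (HG n a Hn ltac:(lra)). fold G in HG. nra. }
  assert (Hprod : Cmod (G - sigma * g) * Cmod (G + sigma * g) <= K / lo / INR n ^ 2).
  { rewrite <- Cmod_mult.
    replace ((G - sigma * g) * (G + sigma * g))%C with (G * G - (sigma * sigma) * (g * g))%C by ring.
    rewrite Hsig. replace (G * G - a1 / a * (g * g))%C with ((a * (G * G) - a1 * (g * g)) / a)%C by (field; assumption).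
    rewrite Cmod_div by assumption.
    assert (Hma : lo <= Cmod a) by (eapply Rle_trans; [exact HRa | apply Re_le_Cmod]).
    assert (Hdist : Cmod (a - a1) <= a0 + delta + a1).
    { eapply Rle_trans; [apply Cmod_triangle_minus|]. rewrite Cmod_R, (Rabs_pos_eq a1) by lra.
      pose proof (near_real_Cmod a a0 delta ltac:(lra) Ha). lra. }
    apply Rle_trans with (K / INR n ^ 2 / Cmod a).
    - apply Rmult_le_compat_r; [left; apply Rinv_0_lt_compat; lra|].
      eapply Rle_trans; [exact B|]. apply Rmult_le_compat_r; [left; apply Rinv_0_lt_compat, pow_lt; lra|].
      apply Rmult_le_compat_l; [apply Rdiv_le_0_compat; lra | assumption].
    - replace (K / lo / INR n ^ 2) with (K / INR n ^ 2 / lo) by (field; lra).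
      apply Rmult_le_compat_l; [apply Rdiv_le_0_compat; [assumption | apply pow_lt; lra]|].
      apply Rinv_le_contravar; assumption. }
  assert (Hcn : 0 < c / sqrt (INR n)) by (apply Rdiv_lt_0_compat; assumption).
  apply (Rmult_le_reg_r (c / sqrt (INR n))); [assumption|].
  apply Rle_trans with (K / lo / INR n ^ 2).
  - eapply Rle_trans; [|exact Hprod]. apply Rmult_le_compat_l; [apply Cmod_ge_0 | assumption].
  - right. replace (INR n ^ 2) with (INR n * (sqrt (INR n) * sqrt (INR n))) by (rewrite sqrt_sqrt by lra; ring).
    field. repeat split; lra.
Qed.

(** The denominator is at least of order [n^(-1/2)] and all replacements cost [n^(-3/2)]; this is
    the origin of the speed [1 / n]. *)
Lemma saddle_integral_ratio (w0 w1 : R) : 0 < w0 -> 0 < w1 -> exists (delta M : R) (N : nat),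
  0 < delta /\ delta <= w0 / 2 /\
  forall (n : nat) (w sigma : C), (1 <= n)%nat -> (N <= n)%nat -> Cmod (w - w0) <= delta ->
    (sigma * sigma)%C = ((1 + w1) / (1 + w))%C -> 0 <= Re sigma ->
    saddle_integral n w1 <> 0%C /\
    Cmod (saddle_integral n w / saddle_integral n w1 - sigma) <= M / INR n.
Proof.
  intros Hw0 Hw1.
  destruct (saddle_integral_gauss w0 Hw0) as (d0 & M0 & Hd0 & Hd0' & HM0 & H0).
  destruct (saddle_integral_gauss w1 Hw1) as (d1 & M1 & Hd1 & _ & HM1 & H1).
  destruct (gauss_integral_ratio (1 + w0) (1 + w1) ltac:(lra) ltac:(lra)) as (d2 & M2 & Hd2 & HM2 & H2).
  set (c := exp (- ((1 + w1) / 2))). assert (Hc : 0 < c) by apply exp_pos.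
  (* From [N] on, the error at [w1] is at most half of the lower bound [2 c / sqrt n] of its
     Gaussian integral, so the denominator stays away from 0. *)
  assert (HN : exists N : nat, M1 / c <= INR N).
  { destruct (INR_unbounded (M1 / c)) as [N HN]. exists N. lra. }
  destruct HN as [N HN].
  (* Crude bound for [|sigma|], from [|sigma|^2 <= 1 + w1]. *)
  set (S := 2 + w1).
  set (K := M0 + M2 + S * M1).
  exists (Rmin d0 d2), (K / c), N.
  pose proof (Rmin_l d0 d2). pose proof (Rmin_r d0 d2).
  split; [apply Rmin_pos; assumption | split; [lra|]].
  intros n w sigma Hn HnN Hw Hsig HRs. assert (Hn1 := INR_ge_1 n Hn).
  assert (HNn : INR N <= INR n) by (apply le_INR, HnN).
  specialize (H0 n w Hn ltac:(lra)).
  specialize (H1 n w1 Hn). replace (w1 - w1)%C with (RtoC 0) in H1 by ring.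
  rewrite Cmod_0 in H1. specialize (H1 ltac:(lra)).
  assert (HRw : 0 < Re w) by (pose proof (near_real_Re w w0 _ Hw); lra).
  assert (H1w : (1 + w)%C <> 0%C).
  { apply Re_pos_neq_0. replace (Re (1 + w)) with (1 + Re w) by reflexivity. lra. }
  specialize (H2 n (1 + w)%C sigma Hn).
  rewrite !RtoC_plus in H2.
  replace (1 + w - (1 + w0))%C with (w - w0)%C in H2 by ring.
  specialize (H2 ltac:(lra) Hsig HRs).
  assert (HS : Cmod sigma <= S).
  { assert (Hq : Cmod sigma * Cmod sigma <= 1 + w1).
    { rewrite <- Cmod_mult, Hsig, Cmod_div by assumption.
      rewrite <- RtoC_plus, Cmod_R, Rabs_pos_eq by lra.
      assert (1 <= Cmod (1 + w)).
      { eapply Rle_trans; [|apply Re_le_Cmod]. replace (Re (1 + w)) with (1 + Re w) by reflexivity. lra. }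
      apply Rle_div_l; nra. }
    unfold S. pose proof (Cmod_ge_0 sigma). nra. }
  set (J := saddle_integral n w) in *. set (J1 := saddle_integral n w1) in *.
  set (G := gauss_integral (INR n * (1 + w))) in *. set (G1 := gauss_integral (INR n * (1 + w1))) in *.
  set (rn := sqrt (INR n)) in *.
  assert (Hrn : 0 < rn) by (apply sqrt_lt_R0; lra).
  assert (Hnr : 0 < INR n * rn) by nra.
  assert (HJ1 : c / rn <= Cmod J1).
  { pose proof (gauss_integral_real_ge (1 + w1) n Hn ltac:(lra)) as L. rewrite RtoC_plus in L.
    fold G1 in L. fold c in L. fold rn in L.
    pose proof (Re_ge_opp_Cmod (J1 - G1)) as P.
    replace (Re (J1 - G1)) with (Re J1 - Re G1) in P by reflexivity.
    pose proof (Re_le_Cmod J1).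
    assert (M1 / (INR n * rn) <= c / rn).
    { apply (Rmult_le_reg_r (INR n * rn)); [assumption|].
      replace (M1 / (INR n * rn) * (INR n * rn)) with M1 by (field; lra).
      replace (c / rn * (INR n * rn)) with (c * INR n) by (field; lra).
      apply (Rmult_le_compat_l c) in HN; [|lra]. replace (c * (M1 / c)) with M1 in HN by (field; lra). nra. }
    replace (2 * c / rn) with (c / rn + c / rn) in L by (field; lra). lra. }
  assert (Hcr : 0 < c / rn) by (apply Rdiv_lt_0_compat; assumption).
  assert (HJ0 : J1 <> 0%C) by (apply Cmod_gt_0; lra).
  split; [exact HJ0|].
  replace (J / J1 - sigma)%C with ((J - sigma * J1) / J1)%C by (field; assumption).
  rewrite Cmod_div by assumption.
  assert (HB : Cmod (J - sigma * J1) <= K / (INR n * rn)).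
  { replace (J - sigma * J1)%C with ((J - G) + ((G - sigma * G1) - sigma * (J1 - G1)))%C by ring.
    eapply Rle_trans; [apply Cmod_triangle|]. unfold K.
    replace ((M0 + M2 + S * M1) / (INR n * rn)) with
      (M0 / (INR n * rn) + (M2 / (INR n * rn) + S * (M1 / (INR n * rn)))) by (field; lra).
    apply Rplus_le_compat; [exact H0|].
    eapply Rle_trans; [apply Cmod_triangle_minus|]. apply Rplus_le_compat; [exact H2|].
    rewrite Cmod_mult. apply Rmult_le_compat; auto using Cmod_ge_0. }
  apply Rle_div_l; [lra|].
  eapply Rle_trans; [exact HB|].
  apply Rle_trans with (K / c / INR n * (c / rn)).
  - right. field. lra.
  - apply Rmult_le_compat_l; [|assumption].
    assert (0 <= K) by (eapply (Rmult_le_reg_r (/ (INR n * rn)));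
      [apply Rinv_0_lt_compat; assumption | rewrite Rmult_0_l; eapply Rle_trans; [apply Cmod_ge_0 | exact HB]]).
    apply Rdiv_le_0_compat; [apply Rdiv_le_0_compat; assumption | lra].
Qed.

(** * Lambert function and conclusion *)

Lemma C_ball_Cmod (z y : C) (e : R) : Cmod (y - z) < e -> ball (M := C_UniformSpace) z e y.
Proof.
  intros H. split.
  - eapply Rle_lt_trans; [apply (re_le_Cmod (y - z)) | exact H].
  - eapply Rle_lt_trans; [apply (Im_le_Cmod (y - z)) | exact H].
Qed.

(** The uniform structure of the plane is that of a product, so its balls are squares; hence the
    factor 2. *)
Lemma Cmod_C_ball (z y : C) (e : R) : ball (M := C_UniformSpace) z e y -> Cmod (y - z) < 2 * e.
Proof.
  intros [H1 H2]. eapply Rle_lt_trans; [apply Cmod_le_Re_Im|].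
  change (Rabs (Re (y - z)) < e) in H1. change (Rabs (Im (y - z)) < e) in H2. lra.
Qed.

Lemma open_Cmod (U : C -> Prop) :
  (forall z, U z -> exists e, 0 < e /\ forall y, Cmod (y - z) < e -> U y) -> open U.
Proof.
  intros H z Hz. destruct (H z Hz) as (e & He & HU).
  exists (mkposreal (e / 2) ltac:(lra)). intros y Hy. apply HU.
  apply Cmod_C_ball in Hy. simpl in Hy. lra.
Qed.

Lemma ex_derive_C_continuous (W : C -> C) (z : C) :
  ex_derive (K := C_AbsRing) (V := C_NormedModule) W z ->
  forall e, 0 < e -> exists d, 0 < d /\ forall y, Cmod (y - z) < d -> Cmod (W y - W z) < e.
Proof.
  intros H e He. apply ex_derive_continuous in H.
  specialize (H _ (locally_ball (W z) (mkposreal (e / 2) ltac:(lra)))).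
  destruct H as [d Hd]. exists d. split; [apply cond_pos|].
  intros y Hy. specialize (Hd y Hy). apply Cmod_C_ball in Hd. simpl in Hd. lra.
Qed.

Section LambertW0.

Variable W0 : C -> C.
Hypothesis HW0 : is_LambertW0 W0.

Local Lemma Re_pos_slit_plane (a : R) (z : C) : a <= 0 -> 0 < Re z -> slit_plane a z.
Proof. intros Ha Hz [_ H]. lra. Qed.

Lemma LambertW0_pos (x : R) : 0 < x -> exists w : R, 0 < w /\ W0 (RtoC x) = RtoC w.
Proof.
  intros Hx. pose proof (exp_pos (-1)).
  destruct (LambertW0_real _ HW0 x ltac:(lra)) as (w & Hw & E). exists w. split; [|exact E].
  assert (Ew : (W0 (RtoC x) * Cexp (W0 (RtoC x)))%C = RtoC x) by (apply (LambertW0_eq _ HW0), Re_pos_slit_plane; simpl; lra).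
  rewrite E, Cexp_RtoC, <- RtoC_mult in Ew. apply RtoC_inj in Ew.
  pose proof (exp_pos w). nra.
Qed.

Lemma LambertW0_continuous (x : R) : 0 < x ->
  forall e, 0 < e -> exists d, 0 < d /\ forall y, Cmod (y - x) < d -> Cmod (W0 y - W0 x) < e.
Proof.
  intros Hx. apply ex_derive_C_continuous, (LambertW0_holomorphic _ HW0), Re_pos_slit_plane; simpl; [|assumption].
  pose proof (exp_pos (-1)); lra.
Qed.

End LambertW0.

Lemma Re_Cexp_pos (z : C) : Rabs (Im z) <= 1 -> 0 < Re (Cexp z).
Proof.
  intros H. change (0 < exp (Re z) * cos (Im z)). apply Rmult_lt_0_compat; [apply exp_pos|].
  pose proof PI2_1. apply Rabs_le_between in H. apply cos_gt_0; lra.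
Qed.

Lemma Re_Cinv_pos (z : C) : 0 < Re z -> 0 < Re (/ z).
Proof.
  intros H. unfold Cinv, Re in *; simpl in *. apply Rdiv_lt_0_compat; [assumption|].
  pose proof (pow2_ge_0 (snd z)). simpl in *. nra.
Qed.

(** The constants are parameters, so that one pair can serve a whole disc and finitely many pairs
    can be merged. *)
Definition good_at (W0 : C -> C) (vartheta M : R) (N : nat) (z : C) : Prop :=
  well_defined_at W0 vartheta z /\
  forall n : nat, (1 <= n)%nat -> (N <= n)%nat ->
    Cmod (mgf_ratio W0 vartheta n z - Csqrt (limit_quotient W0 vartheta z)) <= M / INR n.

Lemma good_near_real (W0 : C -> C) (vartheta x : R) : is_LambertW0 W0 -> 0 < vartheta ->
  exists (e M : R) (N : nat), 0 < e /\ forall z : C, Cmod (z - x) < e -> good_at W0 vartheta M N z.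
Proof.
  intros HW0 Hth.
  set (v0 := / vartheta * exp (- x)).
  assert (Hith : 0 < / vartheta) by (apply Rinv_0_lt_compat, Hth).
  assert (Hv0 : 0 < v0) by (apply Rmult_lt_0_compat; [exact Hith | apply exp_pos]).
  destruct (LambertW0_pos W0 HW0 v0 Hv0) as (w0 & Hw0 & E0).
  destruct (LambertW0_pos W0 HW0 (/ vartheta) Hith) as (w1 & Hw1 & E1).
  destruct (saddle_integral_ratio w0 w1 Hw0 Hw1) as (delta & M & N & Hd & Hd2 & HJ).
  destruct (LambertW0_continuous W0 HW0 v0 Hv0 delta Hd) as (d & Hdp & Hcont).
  (* Lipschitz factor at [x] of [exp (- z) / vartheta] within distance 1 of [x]. *)
  set (L := / vartheta * (2 * exp (- x + 1))).
  assert (HL : 0 < L) by (unfold L; pose proof (exp_pos (- x + 1)); nra).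
  (* Radius at most 1 also gives [|Im z| <= 1], so [exp z] and [exp (- z)] stay in the right
     half-plane, away from the cuts. *)
  exists (Rmin 1 (d / L)), M, N.
  pose proof (Rmin_l 1 (d / L)). pose proof (Rmin_r 1 (d / L)).
  split; [apply Rmin_pos; [lra | apply Rdiv_lt_0_compat; assumption]|].
  intros z Hz.
  assert (HIm : Rabs (Im z) <= 1).
  { pose proof (Im_le_Cmod (z - x)) as P. replace (Im (z - x)) with (Im z) in P by (unfold Im; simpl; ring). lra. }
  assert (HRe : Re (- z) <= - x + 1).
  { pose proof (near_real_Re z x _ (Rlt_le _ _ Hz)). replace (Re (- z)) with (- Re z) by reflexivity. lra. }
  assert (HthC : RtoC vartheta <> 0%C) by (intros E; apply RtoC_inj in E; lra).
  set (v := (/ vartheta * Cexp (- z))%C).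
  assert (Hv : Cmod (v - v0) < d).
  { unfold v, v0. rewrite RtoC_mult, RtoC_inv, <- Cexp_RtoC by lra.
    replace (/ vartheta * Cexp (- z) - / vartheta * Cexp (RtoC (- x)))%C with (/ vartheta * (Cexp (- z) - Cexp (RtoC (- x))))%C by ring.
    rewrite <- RtoC_inv, Cmod_mult, Cmod_R, Rabs_pos_eq by lra.
    pose proof (Cexp_lipschitz (- z) (RtoC (- x)) (- x + 1) HRe ltac:(simpl; lra)) as P.
    replace (Cmod (- z - RtoC (- x))) with (Cmod (z - x)) in P
      by (rewrite <- Cmod_opp; f_equal; rewrite RtoC_opp; ring).
    apply Rle_lt_trans with (L * Cmod (z - x)).
    - unfold L. rewrite Rmult_assoc. apply Rmult_le_compat_l; [lra|]. lra.
    - apply Rlt_le_trans with (L * (d / L)); [apply Rmult_lt_compat_l; lra | right; field; lra]. }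
  set (w := W0 v).
  assert (Hw : Cmod (w - w0) <= delta) by (left; rewrite <- E0; apply Hcont, Hv).
  assert (HRw : 0 < Re w) by (pose proof (near_real_Re w w0 delta Hw); lra).
  assert (HRvz : 0 < Re v).
  { unfold v. rewrite <- RtoC_inv, re_scal_l by lra. apply Rmult_lt_0_compat; [assumption|].
    apply Re_Cexp_pos. replace (Im (- z)) with (- Im z) by reflexivity. rewrite Rabs_Ropp; assumption. }
  pose proof (exp_pos (-1)) as He.
  assert (EW : (w * Cexp w)%C = v) by (apply (LambertW0_eq _ HW0), Re_pos_slit_plane; [lra | assumption]).
  assert (EW1 : (w1 * Cexp w1)%C = (/ vartheta)%C).
  { rewrite <- E1, (LambertW0_eq _ HW0), RtoC_inv by (try apply Re_pos_slit_plane; simpl; lra). reflexivity. }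
  assert (H1w : 0 < Re (w + 1)) by (replace (Re (w + 1)) with (Re w + 1) by reflexivity; lra).
  assert (EQ : limit_quotient W0 vartheta z = ((1 + w1) / (1 + w))%C).
  { unfold limit_quotient. fold v w. rewrite <- RtoC_inv, E1 by lra.
    rewrite (Cplus_comm w1), (Cplus_comm w). reflexivity. }
  split.
  - split; [|split; [|split]].
    + apply Re_pos_slit_plane; [lra|]. rewrite re_scal_l.
      apply Rmult_lt_0_compat; [assumption | apply Re_Cexp_pos, HIm].
    + apply Re_pos_slit_plane; [lra | exact HRvz].
    + apply Re_pos_neq_0, H1w.
    + apply Re_pos_slit_plane; [lra|]. rewrite EQ. unfold Cdiv. rewrite <- RtoC_plus, re_scal_l.
      apply Rmult_lt_0_compat; [lra|]. apply Re_Cinv_pos. rewrite Cplus_comm. exact H1w.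
  - intros n Hn HnN.
    destruct (HJ n w (Csqrt (limit_quotient W0 vartheta z)) Hn HnN Hw) as [HJ1 HB].
    + rewrite Csqrt_sqr. exact EQ.
    + apply Re_Csqrt_ge_0.
    + rewrite (mgf_ratio_saddle W0 vartheta n z w w1 Hn); [exact HB | | | | | exact HJ1].
      * unfold w, v. f_equal. rewrite Cexp_opp. field. split; first [apply Cexp_neq_0 | assumption].
      * rewrite EW. unfold v. rewrite Cexp_opp. field. split; first [apply Cexp_neq_0 | assumption].
      * rewrite <- RtoC_inv by lra. exact E1.
      * rewrite EW1. field. assumption.
Qed.

Theorem theorem2p2 (W0 : C -> C) (HW0 : is_LambertW0 W0)
    (vartheta : R) (Hvartheta : (0 < vartheta)%R) :
  exists D2 : C -> Prop,
    open D2 /\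
    (forall x : R, D2 (RtoC x)) /\
    (forall z : C, D2 z -> well_defined_at W0 vartheta z) /\
    (forall z : C, D2 z ->
       filterlim (fun n : nat => mgf_ratio W0 vartheta n z) eventually
         (locally (Csqrt (limit_quotient W0 vartheta z)))) /\
    (forall K : C -> Prop, compact_C K -> (forall z : C, K z -> D2 z) ->
       exists (M : R) (N : nat), forall n : nat, (N <= n)%nat -> (1 <= n)%nat ->
         forall z : C, K z ->
           (Cmod (Cminus (mgf_ratio W0 vartheta n z)
                         (Csqrt (limit_quotient W0 vartheta z)))
            <= M / INR n)%R).
Proof.
  (* A disc is indexed together with its constants, so a finite subcover also delivers finitely many
     [M] and [N]. *)
  pose (ball_at := fun (i : C * R * R * nat) (y : C) =>
    let '(z, e, M, N) := i in
    Cmod (y - z) < e /\ forall y, Cmod (y - z) < e -> good_at W0 vartheta M N y).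
  assert (ball_open : forall i, open (ball_at i)).
  { intros [[[z e] M] N]. apply open_Cmod. intros y [Hy Hg].
    exists (e - Cmod (y - z)). split; [lra|]. intros u Hu. split; [|exact Hg].
    replace (u - z)%C with ((u - y) + (y - z))%C by ring.
    eapply Rle_lt_trans; [apply Cmod_triangle | lra]. }
  exists (fun z => exists i, ball_at i z).
  split; [|split; [|split; [|split]]].
  - intros z [i Hi]. apply (filter_imp (ball_at i)); [|apply ball_open, Hi].
    intros y Hy; exists i; exact Hy.
  - intros x. destruct (good_near_real W0 vartheta x HW0 Hvartheta) as (e & M & N & He & Hg).
    exists (RtoC x, e, M, N). split; [|exact Hg].
    replace (x - x)%C with (RtoC 0) by ring. rewrite Cmod_0. exact He.
  - intros z [[[[z0 e] M] N] [Hz Hg]]. apply Hg, Hz.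
  - intros z [[[[z0 e] M] N] [Hz Hg]]. destruct (Hg z Hz) as [_ HB].
    apply filterlim_locally. intros eps.
    destruct (INR_unbounded (M / eps)) as [N' HN'].
    (* The successor ensures [n >= 1], where the bound holds. *)
    exists (S (max N N')). intros n Hn. apply C_ball_Cmod.
    assert (Hn1 : 1 <= INR n) by (apply INR_ge_1; lia).
    eapply Rle_lt_trans; [apply HB; lia|].
    assert (INR N' <= INR n) by (apply le_INR; lia).
    pose proof (cond_pos eps) as Hp.
    apply Rlt_div_l; [lra|]. apply Rlt_div_l in HN'; nra.
  - intros K HK HD.
    destruct (HK _ ball_at ball_open HD) as [l Hl].
    assert (Hmax : exists (M : R) (N : nat), forall i, List.In i l ->
      let '(_, _, Mi, Ni) := i in Mi <= M /\ (Ni <= N)%nat).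
    { clear Hl. induction l as [|[[[z e] Mi] Ni] l (M & N & IH)].
      - exists 0, 0%nat. intros i [].
      - exists (Rmax Mi M), (max Ni N). intros i [<-|Hi].
        + split; [apply Rmax_l | lia].
        + specialize (IH i Hi). destruct i as [[[z' e'] Mi'] Ni']. destruct IH.
          split; [eapply Rle_trans; [|apply Rmax_r]; assumption | lia]. }
    destruct Hmax as (M & N & Hmax). exists M, N. intros n HnN Hn z Hz.
    destruct (Hl z Hz) as ([[[z0 e] Mi] Ni] & Hi & Hzi & Hg).
    specialize (Hmax _ Hi). destruct Hmax as [HM HN].
    destruct (Hg z Hzi) as [_ HB].
    eapply Rle_trans; [apply HB; lia|].
    apply Rmult_le_compat_r; [|exact HM]. left; apply Rinv_0_lt_compat, lt_0_INR; lia.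
Qed.
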